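(* Let $\mathcal{M} \models \mathrm{KP}^\mathcal{P}$ be countable and non-standard. The following are equivalent: (a) $\mathcal{M} \models \Sigma_1^\mathcal{P}\text{-Separation}$. (b) For every $\alpha \in \mathrm{Ord}^\mathcal{M}$, there is a proper rank-initial self-embedding of $\mathcal{M}$ which fixes $\mathcal{M}_\alpha$ pointwise.
   Context: $\mathcal{L}^0$ is the first-order language of set theory, with the binary symbol $\in$. Takahashi hierarchy: $\Delta_0^\mathcal{P}=\Sigma_0^\mathcal{P}=\Pi_0^\mathcal{P}$ is the set of $\mathcal{L}^0$-formulae all of whose quantifiers are of the forms $\exists x\in y$, $\forall x\in y$, $\exists x\subseteq y$, $\forall x\subseteq y$; $\Sigma_{n+1}^\mathcal{P}$ consists of formulae $\exists x\,\phi$ with $\phi\in\Pi_n^\mathcal{P}$, and $\Pi_{n+1}^\mathcal{P}$ of formulae $\forall x\,\phi$ with $\phi\in\Sigma_n^\mathcal{P}$ (all up to provable equivalence in $\mathrm{KP}^\mathcal{P}$). $\mathrm{KP}^\mathcal{P}$ has the axioms Extensionality, Pair, Union, Powerset, Infinity, and the schemata (with parameters) $\Delta_0^\mathcal{P}$-Separation, $\Delta_0^\mathcal{P}$-Collection ($\forall x(\forall u\in x\,\exists v\,\phi(u,v)\to\exists y\,\forall u\in x\,\exists v\in y\,\phi(u,v))$), and $\Pi_1^\mathcal{P}$-Foundation ($\exists x\,\phi(x)\to\exists y(\phi(y)\wedge\forall v\in y\,\neg\phi(v))$). $\Gamma$-Separation is the Separation schema (with parameters) for formulae in $\Gamma$.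 A model is non-standard if its interpretation of $\in$ is not well-founded. $\mathrm{Ord}^\mathcal{M}$ is the class of ordinals of $\mathcal{M}$, and $\mathcal{M}_\alpha=\{m\in\mathcal{M}\mid\mathcal{M}\models\mathrm{rank}(m)<\alpha\}$. A self-embedding of $\mathcal{M}$ is an injection $i:\mathcal{M}\to\mathcal{M}$ with $\mathcal{M}\models x\in y\Leftrightarrow\mathcal{M}\models i(x)\in i(y)$. It is proper if it is not onto. It is rank-initial if whenever $m,n\in\mathcal{M}$ and $\mathcal{M}\models\mathrm{rank}(n)\le\mathrm{rank}(i(m))$, then $n\in i(\mathcal{M})$. *)

(* Defs.v *)
From Stdlib Require Import List FinFun.

Set Implicit Arguments.

(** * The first-order language of set theory, with equality *)

(* Variables are de Bruijn indices.  The language has no function symbols, so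
   terms are variables and substitutions are maps [nat -> nat].  The
   connectives other than falsum, implication and universal quantification
   are the usual classical abbreviations. *)
Inductive form : Type :=
| Bot : form
| Eq  : nat -> nat -> form
| Mem : nat -> nat -> form
| Imp : form -> form -> form
| All : form -> form.

Definition Not (p : form) : form := Imp p Bot.
Definition And (p q : form) : form := Not (Imp p (Not q)).
Definition Or (p q : form) : form := Imp (Not p) q.
Definition Iff (p q : form) : form := And (Imp p q) (Imp q p).
Definition Ex (p : form) : form := Not (All (Not p)).
Definition Sub (x y : nat) : form := All (Imp (Mem 0 (S x)) (Mem 0 (S y))).

Definition scons {A : Type} (a : A) (r : nat -> A) (n : nat) : A :=
  match n with 0 => a | S k => r k end.

Definition up (r : nat -> nat) : nat -> nat := scons 0 (fun k => S (r k)).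

Fixpoint ren (r : nat -> nat) (p : form) : form :=
  match p with
  | Bot => Bot
  | Eq x y => Eq (r x) (r y)
  | Mem x y => Mem (r x) (r y)
  | Imp p q => Imp (ren r p) (ren r q)
  | All p => All (ren (up r) p)
  end.

(* Substitutes the variable [t] for the variable 0. *)
Definition inst (t : nat) (p : form) : form := ren (scons t (fun k => k)) p.

Fixpoint sat {M : Type} (E : M -> M -> Prop) (e : nat -> M) (p : form) : Prop :=
  match p with
  | Bot => False
  | Eq x y => e x = e y
  | Mem x y => E (e x) (e y)
  | Imp p q => sat E e p -> sat E e q
  | All p => forall d : M, sat E (scons d e) p
  end.

(* A theory is a set of formulas.  Free variables of axioms are read as
   universally quantified; this is how parameters in schemata are treated. *)
Definition theory : Type := form -> Prop.

Definition models {M : Type} (E : M -> M -> Prop) (T : theory) : Prop :=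
  forall p, T p -> forall e : nat -> M, sat E e p.

(* Classical natural deduction.  Since [nd_ax] is available in every context
   and [nd_allI] does not shift the theory, axioms are used as if universally
   closed. *)
Inductive nd (T : theory) : list form -> form -> Prop :=
| nd_ax G p : T p -> nd T G p
| nd_hyp G p : In p G -> nd T G p
| nd_impI G p q : nd T (p :: G) q -> nd T G (Imp p q)
| nd_impE G p q : nd T G (Imp p q) -> nd T G p -> nd T G q
| nd_raa G p : nd T (Not p :: G) Bot -> nd T G p
| nd_allI G p : nd T (map (ren S) G) p -> nd T G (All p)
| nd_allE G p t : nd T G (All p) -> nd T G (inst t p)
| nd_refl G t : nd T G (Eq t t)
| nd_subst G s t p : nd T G (Eq s t) -> nd T G (inst s p) -> nd T G (inst t p).

Definition provable (T : theory) (p : form) : Prop := nd T nil p.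

(** * The Takahashi hierarchy, syntactically *)

(* In the four quantifier cases the bound [y] lives outside the quantifier,
   hence appears as [S y] below it. *)
Inductive Delta0P : form -> Prop :=
| D0_bot : Delta0P Bot
| D0_eq x y : Delta0P (Eq x y)
| D0_mem x y : Delta0P (Mem x y)
| D0_imp p q : Delta0P p -> Delta0P q -> Delta0P (Imp p q)
| D0_all_in y p : Delta0P p -> Delta0P (All (Imp (Mem 0 (S y)) p))
| D0_ex_in y p : Delta0P p -> Delta0P (Ex (And (Mem 0 (S y)) p))
| D0_all_sub y p : Delta0P p -> Delta0P (All (Imp (Sub 0 (S y)) p))
| D0_ex_sub y p : Delta0P p -> Delta0P (Ex (And (Sub 0 (S y)) p)).

Inductive SigmaP_syn : nat -> form -> Prop :=
| SigmaP_syn0 p : Delta0P p -> SigmaP_syn 0 p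
| SigmaP_synS n p : PiP_syn n p -> SigmaP_syn (S n) (Ex p)
with PiP_syn : nat -> form -> Prop :=
| PiP_syn0 p : Delta0P p -> PiP_syn 0 p
| PiP_synS n p : SigmaP_syn n p -> PiP_syn (S n) (All p).

(** * Axioms *)

Definition ax_ext : form :=
  All (All (Imp (All (Iff (Mem 0 2) (Mem 0 1))) (Eq 1 0))).

Definition ax_pair : form :=
  All (All (Ex (All (Iff (Mem 0 1) (Or (Eq 0 3) (Eq 0 2)))))).

Definition ax_union : form :=
  All (Ex (All (Iff (Mem 0 1) (Ex (And (Mem 0 3) (Mem 1 0)))))).

Definition ax_power : form :=
  All (Ex (All (Iff (Mem 0 1) (Sub 0 2)))).

(* Some set contains the empty set and is closed under u |-> u U {u}. *)
Definition ax_inf : form :=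
  Ex (And
    (Ex (And (Mem 0 1) (All (Not (Mem 0 1)))))
    (All (Imp (Mem 0 1)
      (Ex (And (Mem 0 2) (All (Iff (Mem 0 1) (Or (Mem 0 2) (Eq 0 2))))))))).

(* In [p], variable 0 is x and the variables from 1 on are parameters:
   forall a, exists b, forall x, x in b <-> x in a /\ p(x). *)
Definition sep (p : form) : form :=
  All (Ex (All (Iff (Mem 0 1)
    (And (Mem 0 2) (ren (up (fun k => S (S k))) p))))).

(* In [p], variable 0 is v, variable 1 is u, and the variables from 2 on are
   parameters: forall x, (forall u in x, exists v, p(u,v)) ->
   exists y, forall u in x, exists v in y, p(u,v). *)
Definition coll (p : form) : form :=
  All (Imp
    (All (Imp (Mem 0 1) (Ex (ren (up (up S)) p))))
    (Ex (All (Imp (Mem 0 2)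
      (Ex (And (Mem 0 2) (ren (up (up (fun k => S (S k)))) p))))))).

(* In [p], variable 0 is x and the variables from 1 on are parameters:
   (exists x, p(x)) -> exists y, p(y) /\ forall v in y, ~ p(v). *)
Definition found (p : form) : form :=
  Imp (Ex p)
    (Ex (And p (All (Imp (Mem 0 1) (Not (ren (up S) p)))))).

Inductive KPP : theory :=
| KPP_ext : KPP ax_ext
| KPP_pair : KPP ax_pair
| KPP_union : KPP ax_union
| KPP_power : KPP ax_power
| KPP_inf : KPP ax_inf
| KPP_sep p : Delta0P p -> KPP (sep p)
| KPP_coll p : Delta0P p -> KPP (coll p)
| KPP_found p : PiP_syn 1 p -> KPP (found p).

(* KPP itself is given with the syntactic classes, since provable equivalence
   in KPP presupposes it. *)
Definition SigmaP (n : nat) (p : form) : Prop :=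
  exists q, SigmaP_syn n q /\ provable KPP (Iff p q).

Definition PiP (n : nat) (p : form) : Prop :=
  exists q, PiP_syn n q /\ provable KPP (Iff p q).

Inductive Separation (C : form -> Prop) : theory :=
| Separation_sep p : C p -> Separation C (sep p).

(** * Ordinals and rank inside a structure *)

(* These are the set-theoretic definitions evaluated in (M, E): every
   quantifier ranges over M, so functions and subsets are elements of M. *)
Section Internal.

Variables (M : Type) (E : M -> M -> Prop).

Definition nonstandard : Prop := ~ well_founded E.

Definition subset (x y : M) : Prop := forall z, E z x -> E z y.

Definition transitive_set (x : M) : Prop := forall y, E y x -> subset y x.

(* A transitive set strictly well-ordered by membership. *)
Definition ordinal (a : M) : Prop :=
  transitive_set a /\
  (forall x, E x a -> ~ E x x) /\
  (forall x y z, E x a -> E y a -> E z a -> E x y -> E y z -> E x z) /\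
  (forall x y, E x a -> E y a -> E x y \/ x = y \/ E y x) /\
  (forall s, subset s a -> (exists x, E x s) ->
    exists x, E x s /\ forall y, E y s -> x = y \/ E x y).

(* z = {x, y} *)
Definition unordered_pair (z x y : M) : Prop :=
  forall w, E w z <-> w = x \/ w = y.

(* p = {{x}, {x, y}} *)
Definition ordered_pair (p x y : M) : Prop :=
  forall z, E z p <-> unordered_pair z x x \/ unordered_pair z x y.

Definition maps_to (f x y : M) : Prop := exists p, E p f /\ ordered_pair p x y.

Definition function_on (f d : M) : Prop :=
  (forall p, E p f -> exists x y, E x d /\ ordered_pair p x y) /\
  (forall x, E x d -> exists! y, maps_to f x y).

(* [f] satisfies f(y) = sup {f(z) + 1 | z in y} on the transitive set [t]. *)
Definition rank_function (f t : M) : Prop :=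
  transitive_set t /\ function_on f t /\
  forall y v, E y t -> maps_to f y v ->
    forall w, E w v <->
      exists z u, E z y /\ maps_to f z u /\ (E w u \/ w = u).

Definition is_rank (x r : M) : Prop :=
  exists f t, rank_function f t /\ E x t /\ maps_to f x r.

Definition rank_lt (x a : M) : Prop := exists r, is_rank x r /\ E r a.

Definition rank_le (x y : M) : Prop :=
  exists r s, is_rank x r /\ is_rank y s /\ (E r s \/ r = s).

(** * Self-embeddings *)

Definition self_embedding (i : M -> M) : Prop :=
  Injective i /\ forall x y, E x y <-> E (i x) (i y).

Definition proper (i : M -> M) : Prop := ~ Surjective i.

Definition rank_initial (i : M -> M) : Prop :=
  forall m n, rank_le n (i m) -> exists k, i k = n.

(* [i] fixes M_a = {m | M |= rank(m) < a} pointwise. *)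
Definition fixes_below (i : M -> M) (a : M) : Prop :=
  forall m, rank_lt m a -> i m = m.

End Internal.

Definition countable (M : Type) : Prop := exists f : M -> nat, Injective f.

(* Main.v *)
From Stdlib Require Import List FinFun Lia Arith Cantor.
From Stdlib Require Import Classical FunctionalExtensionality ClassicalEpsilon.
Require Import Defs.

(** From embeddings to separation.  Let [i] be a proper rank-initial
    self-embedding that fixes all parameters and all elements of the set [a].
    Its range contains every element and every subset of each [i y], so [i]
    preserves and reflects Delta_0^P formulas ([i_Delta0P]).  Some [n] lies
    outside the range, and since ranks are linearly ordered the whole range
    lies in the set [level n] of the sets of rank at most that of [n].  Hence if
    [x] in [a] has a witness [y] for a Delta_0^P formula, then [i y] is a
    witness in [level n], and the Sigma_1 instance of separation reduces to one
    with a bounded quantifier ([separation_of_embeddings]).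

    From separation to embeddings.  The embedding is built by back and forth
    along an external descending sequence of ordinals of the model.  Think of a
    game on pairs [level y], [p], where [p] names elements chosen so far, with an
    ordinal [xi] as clock: each round lowers the clock, and either names a new
    element of [level y] or replaces [y] by some [z] in [level y].  The type of
    a position ([typ]) is the set of what is true of the named elements together
    with the types of all positions of the next round.  It is an element of the
    model, defined by recursion on the clock, and all types with clock [xi] lie
    in one set [bound xi].

    The invariant of the construction ([match_below]) is that for every [y]
    there is [y'] in a fixed set [level b] such that the domain side, seen in
    [level y], and the range side, seen in [level y'], have the same type.  At
    the start the two sides are empty, and such a [b] exists because Sigma_1
    separation makes a set of the types that occur and collection then bounds
    the levels where they occur ([match_start]).  Naming a new element on one
    side requires an answer on the other that works for all [y] at once.  If
    every candidate failed at some [y], then collection would bound these [y],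
    and the answer given in a level above all of them would be a contradiction
    ([forth_step], [back_step]).  A nonstandard model has an ordinal that is not
    accessible, so the clock can be lowered infinitely often, and countability
    allows every element to be treated.  The limit is an embedding with range
    inside [level b], hence proper.

    Separation, collection and foundation are available for formulas, while
    the argument uses recursively defined operations such as rank and [typ].
    The first half of the file therefore shows that Delta_1 predicates are
    closed under the usual constructions and that operations defined by
    recursion have Sigma_1 graphs ([recursion]). *)

(** * Classical logic and satisfaction *)

Lemma not_ball {A : Type} (P Q : A -> Prop) :
  ~ (forall d, P d -> Q d) <-> exists d, P d /\ ~ Q d.
Proof.
  split; [| intros (d & Hd & N) H; exact (N (H d Hd))].
  intros N. apply not_all_ex_not in N as [d Hd]. exists d. now apply imply_to_and.
Qed.

Lemma not_bex {A : Type} (P Q : A -> Prop) :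
  ~ (exists d, P d /\ Q d) <-> forall d, P d -> ~ Q d.
Proof. split; [intros N d Hd Hq; apply N; eauto | intros H (d & Hd & Hq); exact (H d Hd Hq)]. Qed.

Section Satisfaction.

Variables (M : Type) (E : M -> M -> Prop).

Lemma sat_And e p q : sat E e (And p q) <-> sat E e p /\ sat E e q.
Proof. cbn. tauto. Qed.

Lemma sat_Or e p q : sat E e (Or p q) <-> sat E e p \/ sat E e q.
Proof. cbn. tauto. Qed.

Lemma sat_Iff e p q : sat E e (Iff p q) <-> (sat E e p <-> sat E e q).
Proof. unfold Iff. rewrite sat_And. reflexivity. Qed.

Lemma sat_Ex e p : sat E e (Ex p) <-> exists d, sat E (scons d e) p.
Proof.
  cbn. split.
  - intros H. apply NNPP. intros N. apply H. intros d Hd. eauto.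
  - intros [d Hd] H. exact (H d Hd).
Qed.

Lemma scons_comp_up (d : M) e r :
  (fun k => scons d e (up r k)) = scons d (fun k => e (r k)).
Proof. extensionality k. now destruct k. Qed.

Lemma sat_ren p : forall e r, sat E e (ren r p) <-> sat E (fun k => e (r k)) p.
Proof.
  induction p; intros e r; cbn; try tauto.
  - rewrite IHp1, IHp2. reflexivity.
  - split; intros H d; specialize (H d);
      [rewrite IHp, scons_comp_up in H | rewrite IHp, scons_comp_up]; exact H.
Qed.

Lemma sat_inst e t p : sat E e (inst t p) <-> sat E (scons (e t) e) p.
Proof.
  unfold inst. rewrite sat_ren.
  replace (fun k => e (scons t (fun k => k) k)) with (scons (e t) e); [reflexivity |].
  extensionality k. now destruct k.
Qed.

Lemma nd_sound T G p :
  nd T G p -> models E T -> forall e, (forall g, In g G -> sat E e g) -> sat E e p.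
Proof.
  intros D HT. induction D; intros e HG; cbn in *.
  - now apply HT.
  - now apply HG.
  - intros Hp. apply IHD. intros g [<- | Hg]; auto.
  - exact (IHD1 e HG (IHD2 e HG)).
  - apply NNPP. intros N. apply (IHD e). intros g [<- | Hg]; auto.
  - intros d. apply IHD. intros g Hg. apply in_map_iff in Hg as [h [<- Hh]].
    apply sat_ren. exact (HG h Hh).
  - apply sat_inst. exact (IHD e HG (e t)).
  - reflexivity.
  - apply sat_inst. specialize (IHD1 e HG). cbn in IHD1. rewrite <- IHD1.
    apply sat_inst. exact (IHD2 e HG).
Qed.

Lemma sat_finite_support p :
  exists N, forall e e', (forall k, k < N -> e k = e' k) -> sat E e p <-> sat E e' p.
Proof.
  induction p as [| x y | x y | p [N1 H1] q [N2 H2] | p [N H]].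
  - exists 0. reflexivity.
  - exists (S (x + y)). intros e e' He. cbn. rewrite !He by lia. reflexivity.
  - exists (S (x + y)). intros e e' He. cbn. rewrite !He by lia. reflexivity.
  - exists (N1 + N2). intros e e' He. cbn.
    rewrite (H1 e e'), (H2 e e'); [reflexivity | |]; intros k Hk; apply He; lia.
  - exists N. intros e e' He. cbn.
    assert (K : forall d, sat E (scons d e) p <-> sat E (scons d e') p).
    { intros d. apply H. intros [| k] Hk; cbn; [reflexivity |]. apply He. lia. }
    split; intros A d; apply K, A.
Qed.

End Satisfaction.

Lemma Delta0P_ren p : Delta0P p -> forall r, Delta0P (ren r p).
Proof.
  intros D. induction D; intros r; (constructor; auto; fail).
Qed.

Lemma provable_Iff_refl T p : provable T (Iff p p).
Proof.
  assert (I : forall G, nd T G (Imp p p)).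
  { intros G. apply nd_impI, nd_hyp. now left. }
  apply nd_impI. eapply nd_impE; [| apply I]. eapply nd_impE; [| apply I].
  apply nd_hyp. now left.
Qed.

Lemma dependent_choice (A : Type) (R : nat -> A -> A -> Prop) (a : A) :
  (forall k x, exists y, R k x y) ->
  exists f : nat -> A, f 0 = a /\ forall k, R k (f k) (f (S k)).
Proof.
  intros HR.
  set (next := fun k x => proj1_sig (constructive_indefinite_description _ (HR k x))).
  exists (nat_rect (fun _ => A) a next). split; [reflexivity |].
  intros k. exact (proj2_sig (constructive_indefinite_description _ (HR k _))).
Qed.

(** * Definable predicates of a structure *)

Section Model.

Variables (M : Type) (E : M -> M -> Prop).
Hypothesis HM : models E KPP.
Variable point : M.

Local Notation "x ∈ y" := (E x y) (at level 70).
Local Notation "x ⊆ y" := (subset E x y) (at level 70).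

Definition value (e : nat -> M) (v : nat + M) : M :=
  match v with inl k => e k | inr m => m end.

(** A variable of the defining formula may stand for an entry of the
    environment or for a fixed element of the structure.  Parameters are thus
    invisible in the predicate [P], so that predicates written with elements
    of [M] in them can be used directly.  Entry 0 of the environment is the
    innermost bound variable. *)
Definition D0 (P : (nat -> M) -> Prop) : Prop :=
  exists p r, Delta0P p /\
    forall e, sat E (fun k => value e (r k)) p <-> P e.

Definition S1 (P : (nat -> M) -> Prop) : Prop :=
  exists Q : M -> (nat -> M) -> Prop,
    D0 (fun e => Q (e 0) (fun k => e (S k))) /\
    forall e, P e <-> exists w, Q w e.

Definition D1 (P : (nat -> M) -> Prop) : Prop := S1 P /\ S1 (fun e => ~ P e).

Definition is_var (t : (nat -> M) -> M) : Prop :=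
  exists v, forall e, t e = value e v.

(** Total operations with a Sigma_1 graph.  Their graphs are then Delta_1, and
    they can be substituted into definable predicates. *)
Definition term (t : (nat -> M) -> M) : Prop :=
  S1 (fun e => e 0 = t (fun k => e (S k))).

(* The goal states that two environments, equal entry by entry, satisfy the
   same predicate. *)
Ltac same_env k :=
  match goal with
  | |- sat _ ?a _ <-> sat _ ?b _ => replace b with a; [reflexivity |]
  | |- _ _ ?a <-> _ _ ?b => replace b with a; [reflexivity |]
  end;
  extensionality k.

Lemma D0_ext P Q : (forall e, P e <-> Q e) -> D0 P -> D0 Q.
Proof.
  intros H (p & r & Dp & Hp). exists p, r. split; [exact Dp |].
  intros e. rewrite Hp. apply H.
Qed.

Lemma D0_subst P (s : nat -> nat + M) :
  D0 P -> D0 (fun e => P (fun k => value e (s k))).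
Proof.
  intros (p & r & Dp & Hp).
  exists p, (fun k => match r k with inl j => s j | inr m => inr m end).
  split; [exact Dp |]. intros e. rewrite <- Hp.
  same_env k. now destruct (r k).
Qed.

Lemma D0_eq x y : is_var x -> is_var y -> D0 (fun e => x e = y e).
Proof.
  intros [v Hv] [w Hw]. exists (Eq 0 1), (scons v (fun _ => w)).
  split; [constructor |]. intros e. cbn. rewrite Hv, Hw. reflexivity.
Qed.

Lemma D0_mem x y : is_var x -> is_var y -> D0 (fun e => x e ∈ y e).
Proof.
  intros [v Hv] [w Hw]. exists (Mem 0 1), (scons v (fun _ => w)).
  split; [constructor |]. intros e. cbn. rewrite Hv, Hw. reflexivity.
Qed.

Lemma D0_imp P Q : D0 P -> D0 Q -> D0 (fun e => P e -> Q e).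
Proof.
  intros (p & r & Dp & Hp) (q & s & Dq & Hq).
  (* Even and odd variables keep the readings of the two formulas apart. *)
  exists (Imp (ren (fun k => 2 * k) p) (ren (fun k => S (2 * k)) q)),
    (fun k => if Nat.even k then r (Nat.div2 k) else s (Nat.div2 k)).
  split; [constructor; now apply Delta0P_ren |].
  intros e. cbn [sat]. rewrite !sat_ren, <- Hp, <- Hq.
  replace (fun k => value e (if Nat.even (2 * k) then r (Nat.div2 (2 * k))
                             else s (Nat.div2 (2 * k))))
    with (fun k => value e (r k)).
  2:{ extensionality k. now rewrite Nat.even_even, Nat.div2_double. }
  replace (fun k => value e (if Nat.even (S (2 * k)) then r (Nat.div2 (S (2 * k)))
                             else s (Nat.div2 (S (2 * k)))))
    with (fun k => value e (s k)).
  2:{ extensionality k. rewrite Nat.div2_succ_double.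
      replace (S (2 * k)) with (2 * k + 1) by lia. now rewrite Nat.even_odd. }
  reflexivity.
Qed.

Lemma D0_False : D0 (fun _ => False).
Proof. exists Bot, (fun k => inl k). split; [constructor | reflexivity]. Qed.

Lemma D0_not P : D0 P -> D0 (fun e => ~ P e).
Proof. intros H. exact (D0_imp _ _ H D0_False). Qed.

Lemma D0_and P Q : D0 P -> D0 Q -> D0 (fun e => P e /\ Q e).
Proof.
  intros HP HQ. apply (D0_ext (fun e => ~ (P e -> ~ Q e))); [intros e; tauto |].
  auto using D0_not, D0_imp.
Qed.

(** A variable of the matrix that reads the quantified entry becomes variable 0.
    Outside the quantifier, variable 0 reads the bound, which moves the variable
    [k] of the matrix to [k + 1] there and to [k + 2] under the quantifier. *)
Definition under (r : nat -> nat + M) (k : nat) : nat :=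
  match r k with inl 0 => 0 | _ => S (S k) end.

Definition outer (v : nat + M) (r : nat -> nat + M) (k : nat) : nat + M :=
  match k with
  | 0 => v
  | S k => match r k with inl (S j) => inl j | inl 0 => v | inr m => inr m end
  end.

Lemma under_outer v r e d p :
  sat E (scons d (fun k => value e (outer v r k))) (ren (under r) p) <->
  sat E (fun k => value (scons d e) (r k)) p.
Proof.
  rewrite sat_ren.
  same_env k. unfold under.
  destruct (r k) as [[| j] | m] eqn:Hr; cbn; try reflexivity; now rewrite Hr.
Qed.

Lemma D0_ball (P : (nat -> M) -> M -> Prop) y :
  is_var y -> D0 (fun e => P (fun k => e (S k)) (e 0)) ->
  D0 (fun e => forall d, d ∈ y e -> P e d).
Proof.
  intros [v Hv] (p & r & Dp & Hp).
  exists (All (Imp (Mem 0 1) (ren (under r) p))), (outer v r).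
  split; [apply D0_all_in, Delta0P_ren, Dp |].
  intros e. cbn [sat]. rewrite Hv.
  split; intros H d Hd; specialize (H d Hd);
    [apply under_outer, Hp in H | apply under_outer, Hp]; exact H.
Qed.

Lemma D0_ball_sub (P : (nat -> M) -> M -> Prop) y :
  is_var y -> D0 (fun e => P (fun k => e (S k)) (e 0)) ->
  D0 (fun e => forall d, d ⊆ y e -> P e d).
Proof.
  intros [v Hv] (p & r & Dp & Hp).
  exists (All (Imp (Sub 0 1) (ren (under r) p))), (outer v r).
  split; [apply D0_all_sub, Delta0P_ren, Dp |].
  intros e. cbn [sat]. rewrite Hv.
  split; intros H d Hd; specialize (H d Hd);
    [apply under_outer, Hp in H | apply under_outer, Hp]; exact H.
Qed.

Lemma D0_bex (P : (nat -> M) -> M -> Prop) y :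
  is_var y -> D0 (fun e => P (fun k => e (S k)) (e 0)) ->
  D0 (fun e => exists d, d ∈ y e /\ P e d).
Proof.
  intros Hy HP. apply (D0_ext (fun e => ~ forall d, d ∈ y e -> ~ P e d)).
  - intros e. rewrite <- not_bex. tauto.
  - apply D0_not, (D0_ball (fun e d => ~ P e d) y Hy), D0_not, HP.
Qed.

(** The axiom schemata speak of a formula whose first variables are the
    arguments and whose other variables are parameters; this lemma brings a
    predicate into that form. *)
Lemma D0_binary (R : M -> M -> Prop) :
  D0 (fun e => R (e 0) (e 1)) ->
  exists p c, Delta0P p /\ forall x y, sat E (scons x (scons y c)) p <-> R x y.
Proof.
  intros (p & r & Dp & Hp).
  exists (ren (fun k => match r k with inl 0 => 0 | inl 1 => 1 | _ => S (S k) end) p),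
    (fun k => match r k with inr m => m | _ => point end).
  split; [now apply Delta0P_ren |]. intros x y. rewrite sat_ren.
  rewrite <- (Hp (scons x (scons y (fun _ => point)))).
  same_env k. destruct (r k) as [[| [| j]] | m] eqn:Hr; cbn; now rewrite ?Hr.
Qed.

Lemma D0_collection (R : M -> M -> Prop) :
  D0 (fun e => R (e 0) (e 1)) ->
  forall a, (forall u, u ∈ a -> exists v, R v u) ->
  exists y, forall u, u ∈ a -> exists v, v ∈ y /\ R v u.
Proof.
  intros HR a Ha. destruct (D0_binary R HR) as (p & c & Dp & Hp).
  assert (K : forall v u b c', sat E (scons v (scons u b)) (ren (up (up c')) p) <->
                               sat E (scons v (scons u (fun k => b (c' k)))) p).
  { intros. rewrite sat_ren, !scons_comp_up. reflexivity. }
  assert (H : sat E (scons a c)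
     (Ex (All (Imp (Mem 0 2) (Ex (And (Mem 0 2) (ren (up (up (fun k => S (S k)))) p))))))).
  { apply (HM _ (KPP_coll Dp) c a). intros u Hu. apply sat_Ex.
    destruct (Ha u Hu) as [v Hv]. exists v. apply K, Hp, Hv. }
  apply sat_Ex in H as [y Hy]. exists y. intros u Hu.
  specialize (Hy u Hu). apply sat_Ex in Hy as [v Hv]. exists v.
  apply sat_And in Hv as [Hv1 Hv2]. split; [exact Hv1 |]. apply K in Hv2. apply Hp, Hv2.
Qed.

Lemma D0_separation (P : M -> Prop) :
  D0 (fun e => P (e 0)) ->
  forall a, exists b, forall x, x ∈ b <-> x ∈ a /\ P x.
Proof.
  intros HP a. destruct (D0_binary (fun x _ => P x) HP) as (p & c & Dp & Hp).
  assert (H := HM _ (KPP_sep Dp) (scons point c) a).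
  apply sat_Ex in H as [b Hb]. exists b. intros x.
  specialize (Hb x). rewrite sat_Iff, sat_And, sat_ren, scons_comp_up in Hb.
  rewrite <- (Hp x point). exact Hb.
Qed.

Lemma S1_ext P Q : (forall e, P e <-> Q e) -> S1 P -> S1 Q.
Proof.
  intros H (R & DR & HR). exists R. split; [exact DR |].
  intros e. rewrite <- H. apply HR.
Qed.

Lemma S1_D0 P : D0 P -> S1 P.
Proof.
  intros H. exists (fun _ e => P e). split.
  - exact (D0_subst P (fun k => inl (S k)) H).
  - intros e. split; [intros K; exists point; exact K | now intros [_ K]].
Qed.

Lemma D1_D0 P : D0 P -> D1 P.
Proof. intros H. split; apply S1_D0; [exact H | now apply D0_not]. Qed.

Lemma S1_subst P (s : nat -> nat + M) :
  S1 P -> S1 (fun e => P (fun k => value e (s k))).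
Proof.
  intros (Q & DQ & HQ). exists (fun w e => Q w (fun k => value e (s k))). split.
  - refine (D0_ext _ _ _ (D0_subst _ (fun k => match k with 0 => inl 0 | S k =>
      match s k with inl j => inl (S j) | inr m => inr m end end) DQ)).
    intros e. cbn.
    replace (fun k => value e match s k with inl j => inl (S j) | inr m => inr m end)
      with (fun k => value (fun k => e (S k)) (s k)); [reflexivity |].
    extensionality k. now destruct (s k).
  - intros e. apply HQ.
Qed.

Lemma D1_subst P (s : nat -> nat + M) :
  D1 P -> D1 (fun e => P (fun k => value e (s k))).
Proof. intros [H1 H2]. split; [| apply (S1_subst (fun e => ~ P e))]; auto using S1_subst. Qed.

(** * Basic set operations *)

Lemma extensionality_sets x y : (forall z, z ∈ x <-> z ∈ y) -> x = y.
Proof.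
  intros H. apply (HM _ KPP_ext (fun _ => x) x y).
  intros z. apply sat_Iff. apply H.
Qed.

Lemma union_exists a : exists b, forall x, x ∈ b <-> exists y, y ∈ a /\ x ∈ y.
Proof.
  assert (H := HM _ KPP_union (fun _ => a) a). apply sat_Ex in H as [b Hb].
  exists b. intros x. specialize (Hb x).
  rewrite sat_Iff, sat_Ex in Hb. rewrite Hb.
  split; intros [y Hy]; exists y; [apply sat_And in Hy | apply sat_And]; exact Hy.
Qed.

Lemma pair_exists a b : exists c, forall x, x ∈ c <-> x = a \/ x = b.
Proof.
  assert (H := HM _ KPP_pair (fun _ => a) a b). apply sat_Ex in H as [c Hc].
  exists c. intros x. specialize (Hc x). rewrite sat_Iff, sat_Or in Hc. exact Hc.
Qed.

Lemma power_exists a : exists b, forall x, x ∈ b <-> x ⊆ a.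
Proof.
  assert (H := HM _ KPP_power (fun _ => a) a). apply sat_Ex in H as [b Hb].
  exists b. intros x. specialize (Hb x). rewrite sat_Iff in Hb. exact Hb.
Qed.

(** Set-theoretic operations as functions on [M], picked by choice.  Facts about
    their values need the existence of the set in question. *)
Definition the_set (P : M -> Prop) : M :=
  epsilon (inhabits point) (fun b => forall x, x ∈ b <-> P x).

Lemma in_the_set P : (exists b, forall x, x ∈ b <-> P x) ->
  forall x, x ∈ the_set P <-> P x.
Proof. intros H. exact (epsilon_spec (inhabits point) _ H). Qed.

Definition Un (a : M) : M := the_set (fun x => exists y, y ∈ a /\ x ∈ y).
Definition upair (a b : M) : M := the_set (fun x => x = a \/ x = b).
Definition Pw (a : M) : M := the_set (fun x => x ⊆ a).
Definition compr (a : M) (P : M -> Prop) : M := the_set (fun x => x ∈ a /\ P x).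
Definition rep (a : M) (F : M -> M) : M :=
  the_set (fun y => exists x, x ∈ a /\ y = F x).

Lemma in_Un a x : x ∈ Un a <-> exists y, y ∈ a /\ x ∈ y.
Proof. exact (in_the_set _ (union_exists a) x). Qed.

Lemma in_upair a b x : x ∈ upair a b <-> x = a \/ x = b.
Proof. exact (in_the_set _ (pair_exists a b) x). Qed.

Lemma in_Pw a x : x ∈ Pw a <-> x ⊆ a.
Proof. exact (in_the_set _ (power_exists a) x). Qed.

(** * Closure properties of the definable classes *)

Lemma is_var_entry k : is_var (fun e => e k).
Proof. now exists (inl k). Qed.

Lemma is_var_const m : is_var (fun _ => m).
Proof. now exists (inr m). Qed.

Ltac D0_step :=
  first
    [ apply is_var_const | apply is_var_entry
    | apply D0_False | apply D0_and
    | apply (D0_ball _ _) | apply (D0_ball_sub _ _) | apply (D0_bex _ _)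
    | apply D0_imp | apply D0_eq | apply D0_mem ];
  cbv beta.

Lemma S1_and P Q : S1 P -> S1 Q -> S1 (fun e => P e /\ Q e).
Proof.
  intros (P' & DP & HP) (Q' & DQ & HQ).
  exists (fun W e => exists w, w ∈ W /\ exists w', w' ∈ W /\ P' w e /\ Q' w' e). split.
  - do 2 (apply D0_bex; [apply is_var_entry |]). apply D0_and.
    + exact (D0_subst _ (fun k => match k with 0 => inl 1 | S k => inl (S (S (S k))) end) DP).
    + exact (D0_subst _ (fun k => match k with 0 => inl 0 | S k => inl (S (S (S k))) end) DQ).
  - intros e. rewrite HP, HQ.
    split; [| intros (W & w & _ & w' & _ & Hw & Hw'); eauto].
    intros [[w Hw] [w' Hw']]. exists (upair w w'), w.
    split; [apply in_upair; auto |]. exists w'. split; [apply in_upair |]; auto.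
Qed.

Lemma S1_ex (P : (nat -> M) -> M -> Prop) :
  S1 (fun e => P (fun k => e (S k)) (e 0)) -> S1 (fun e => exists d, P e d).
Proof.
  intros (P' & DP & HP).
  exists (fun W e => exists w, w ∈ W /\ exists d, d ∈ W /\ P' w (scons d e)). split.
  - do 2 (apply D0_bex; [apply is_var_entry |]).
    refine (D0_ext _ _ _ (D0_subst _ (fun k => match k with 0 => inl 1 | 1 => inl 0
              | S k => inl (S (S k)) end) DP)).
    intros e. cbn.
    same_env k. now destruct k.
  - intros e. split.
    + intros [d Hd]. apply (HP (scons d e)) in Hd as [w Hw].
      exists (upair w d), w. split; [apply in_upair; auto |].
      exists d. split; [apply in_upair |]; auto.
    + intros (W & w & _ & d & _ & Hd). exists d. apply (HP (scons d e)). eauto.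
Qed.

Lemma S1_or P Q : S1 P -> S1 Q -> S1 (fun e => P e \/ Q e).
Proof.
  intros (P' & DP & HP) (Q' & DQ & HQ).
  exists (fun w e => P' w e \/ Q' w e). split.
  - apply (D0_ext (fun e => ~ P' (e 0) (fun k => e (S k)) -> Q' (e 0) (fun k => e (S k)))).
    + intros e. tauto.
    + apply D0_imp; [now apply D0_not | exact DQ].
  - intros e. rewrite HP, HQ. split; [intros [[w Hw] | [w Hw]] | intros [w [Hw | Hw]]]; eauto.
Qed.

(** Collection turns a bounded universal quantifier over existential
    statements into a single existential one. *)
Lemma S1_ball_var (P : (nat -> M) -> M -> Prop) y :
  is_var y -> S1 (fun e => P (fun k => e (S k)) (e 0)) ->
  S1 (fun e => forall d, d ∈ y e -> P e d).
Proof.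
  intros [v Hv] (P' & DP & HP).
  exists (fun W e => forall d, d ∈ y e -> exists w, w ∈ W /\ P' w (scons d e)). split.
  - apply D0_ball.
    { exists (match v with inl k => inl (S k) | inr m => inr m end).
      intros e. rewrite Hv. now destruct v. }
    apply D0_bex; [apply is_var_entry |].
    refine (D0_ext _ _ _ (D0_subst _ (fun k => match k with 0 => inl 0 | 1 => inl 1
              | S k => inl (S (S k)) end) DP)).
    intros e. cbn.
    same_env k. now destruct k.
  - intros e. split.
    + intros H. apply (D0_collection (fun w d => P' w (scons d e))).
      * refine (D0_ext _ _ _ (D0_subst _ (fun k => match k with 0 => inl 0 | 1 => inl 1
              | S (S k) => inr (e k) end) DP)).
        intros e'. cbn.
        same_env k. now destruct k.
      * intros d Hd. apply (HP (scons d e)), H, Hd.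
    + intros [W HW] d Hd. destruct (HW d Hd) as (w & _ & Hw).
      apply (HP (scons d e)). eauto.
Qed.

(* Entry 0 of the environment moves to place [i], and the others keep their
   order from place [j] on. *)
Local Notation shift i j :=
  (fun k => match k with 0 => inl i | S k => inl (j + k) end).

Lemma term_weaken t : term t -> term (fun e => t (fun k => e (S k))).
Proof. intros H. exact (S1_subst _ (shift 0 2) H). Qed.

(** [t e] is the unique witness of an existential quantifier, which is how
    operations are substituted into definable predicates. *)
Lemma S1_let (P : (nat -> M) -> M -> Prop) t :
  term t -> S1 (fun e => P (fun k => e (S k)) (e 0)) -> S1 (fun e => P e (t e)).
Proof.
  intros Ht HP. apply (S1_ext (fun e => exists d, d = t e /\ P e d)).
  - intros e. split; [intros [d [-> H]]; exact H | eauto].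
  - apply (S1_ex (fun e d => d = t e /\ P e d)). now apply S1_and.
Qed.

Lemma D1_let (P : (nat -> M) -> M -> Prop) t :
  term t -> D1 (fun e => P (fun k => e (S k)) (e 0)) -> D1 (fun e => P e (t e)).
Proof.
  intros Ht [H1 H2]. split; [now apply S1_let |].
  now apply (S1_let (fun e d => ~ P e d)).
Qed.

Lemma term_const m : term (fun _ => m).
Proof. apply S1_D0. repeat D0_step. Qed.

Lemma term_entry k : term (fun e => e k).
Proof. apply S1_D0. repeat D0_step. Qed.

Lemma D1_eq t u : term t -> term u -> D1 (fun e => t e = u e).
Proof.
  intros Ht Hu. apply (D1_let (fun e x => x = u e)); [exact Ht |].
  apply (D1_let (fun e x => e 0 = x)); [now apply term_weaken |].
  apply D1_D0. repeat D0_step.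
Qed.

Lemma D1_mem t u : term t -> term u -> D1 (fun e => t e ∈ u e).
Proof.
  intros Ht Hu. apply (D1_let (fun e x => x ∈ u e)); [exact Ht |].
  apply (D1_let (fun e x => e 0 ∈ x)); [now apply term_weaken |].
  apply D1_D0. repeat D0_step.
Qed.

Lemma S1_ball (P : (nat -> M) -> M -> Prop) t :
  term t -> S1 (fun e => P (fun k => e (S k)) (e 0)) ->
  S1 (fun e => forall d, d ∈ t e -> P e d).
Proof.
  intros Ht HP. apply (S1_let (fun e a => forall d, d ∈ a -> P e d)); [exact Ht |].
  apply (S1_ball_var (fun e d => P (fun k => e (S k)) d)); [apply is_var_entry |].
  exact (S1_subst _ (shift 0 2) HP).
Qed.

Lemma D1_not P : D1 P -> D1 (fun e => ~ P e).
Proof.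
  intros [H1 H2]. split; [exact H2 |].
  apply (S1_ext P); [intros e; tauto | exact H1].
Qed.

Lemma D1_and P Q : D1 P -> D1 Q -> D1 (fun e => P e /\ Q e).
Proof.
  intros [P1 P2] [Q1 Q2]. split; [now apply S1_and |].
  apply (S1_ext (fun e => ~ P e \/ ~ Q e)); [intros e; tauto | now apply S1_or].
Qed.

Lemma D1_or P Q : D1 P -> D1 Q -> D1 (fun e => P e \/ Q e).
Proof.
  intros [P1 P2] [Q1 Q2]. split; [now apply S1_or |].
  apply (S1_ext (fun e => ~ P e /\ ~ Q e)); [intros e; tauto | now apply S1_and].
Qed.

Lemma D1_imp P Q : D1 P -> D1 Q -> D1 (fun e => P e -> Q e).
Proof.
  intros [P1 P2] [Q1 Q2]. split.
  - apply (S1_ext (fun e => ~ P e \/ Q e)); [intros e; tauto | now apply S1_or].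
  - apply (S1_ext (fun e => P e /\ ~ Q e)); [intros e; tauto | now apply S1_and].
Qed.

Lemma D1_iff P Q : D1 P -> D1 Q -> D1 (fun e => P e <-> Q e).
Proof. intros HP HQ. apply D1_and; now apply D1_imp. Qed.

Lemma D1_ball (P : (nat -> M) -> M -> Prop) t :
  term t -> D1 (fun e => P (fun k => e (S k)) (e 0)) ->
  D1 (fun e => forall d, d ∈ t e -> P e d).
Proof.
  intros Ht [P1 P2]. split; [now apply S1_ball |].
  apply (S1_ext (fun e => exists d, d ∈ t e /\ ~ P e d)).
  - intros e. symmetry. apply not_ball.
  - apply (S1_ex (fun e d => d ∈ t e /\ ~ P e d)). apply S1_and; [| exact P2].
    apply D1_mem; [apply term_entry | now apply term_weaken].
Qed.

Lemma D1_bex (P : (nat -> M) -> M -> Prop) t :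
  term t -> D1 (fun e => P (fun k => e (S k)) (e 0)) ->
  D1 (fun e => exists d, d ∈ t e /\ P e d).
Proof.
  intros Ht [P1 P2]. split.
  - apply (S1_ex (fun e d => d ∈ t e /\ P e d)). apply S1_and; [| exact P1].
    apply D1_mem; [apply term_entry | now apply term_weaken].
  - apply (S1_ext (fun e => forall d, d ∈ t e -> ~ P e d)).
    + intros e. symmetry. apply not_bex.
    + now apply (S1_ball (fun e d => ~ P e d)).
Qed.

Lemma D1_subset t u : term t -> term u -> D1 (fun e => t e ⊆ u e).
Proof.
  intros Ht Hu. apply (D1_ball (fun e z => z ∈ u e)); [exact Ht |].
  apply D1_mem; [apply term_entry | now apply term_weaken].
Qed.

Lemma term_graph t : S1 (fun e => e 0 = t (fun k => e (S k))) -> term t.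
Proof. exact (fun H => H). Qed.

(** An operation with a Sigma_1 graph may be applied to any term. *)
Lemma term_let (F : (nat -> M) -> M -> M) t :
  term (fun e => F (fun k => e (S k)) (e 0)) -> term t -> term (fun e => F e (t e)).
Proof.
  intros HF Ht. apply term_graph.
  apply (S1_let (fun e x => e 0 = F (fun k => e (S k)) x)); [now apply term_weaken |].
  exact (S1_subst _ (fun k => match k with 0 => inl 1 | 1 => inl 0
                              | S (S k) => inl (S (S k)) end) HF).
Qed.

Definition term1 (F : M -> M) : Prop :=
  forall t, term t -> term (fun e => F (t e)).

Lemma term1_graph F : S1 (fun e => e 0 = F (e 1)) -> term1 F.
Proof.
  intros HF t Ht. apply (term_let (fun _ x => F x)); [| exact Ht].
  exact HF.
Qed.

Lemma term2_graph F :
  S1 (fun e => e 0 = F (e 1) (e 2)) ->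
  forall t u, term t -> term u -> term (fun e => F (t e) (u e)).
Proof.
  intros HF t u Ht Hu. apply (term_let (fun e x => F x (u e))); [| exact Ht].
  apply (term_let (fun e y => F (e 0) y)); [| now apply term_weaken].
  exact (S1_subst _ (fun k => match k with 0 => inl 0 | 1 => inl 2
                              | 2 => inl 1 | _ => inl k end) HF).
Qed.

Lemma term1_intro F : term (fun e => F (e 0)) -> term1 F.
Proof. exact (term1_graph F). Qed.

Lemma term2_intro F :
  term (fun e => F (e 0) (e 1)) ->
  forall t u, term t -> term u -> term (fun e => F (t e) (u e)).
Proof. exact (term2_graph F). Qed.

Lemma D1_intro (P : M -> Prop) t :
  D1 (fun e => P (e 0)) -> term t -> D1 (fun e => P (t e)).
Proof.
  intros HP Ht. apply (D1_let (fun _ x => P x)); [exact Ht |].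
  exact (D1_subst _ (fun k => match k with 0 => inl 0 | S k => inr point end) HP).
Qed.

Lemma S1_intro (P : M -> Prop) t :
  S1 (fun e => P (e 0)) -> term t -> S1 (fun e => P (t e)).
Proof.
  intros HP Ht. apply (S1_let (fun _ x => P x)); [exact Ht |].
  exact (S1_subst _ (fun k => match k with 0 => inl 0 | S k => inr point end) HP).
Qed.

Lemma S1_D1 P : D1 P -> S1 P.
Proof. exact (@proj1 _ _). Qed.

(* Proves definability by following the shape of the predicate.  Operations are
   recognized by their head symbol, as unification would unfold them; [def_user]
   is extended whenever operations are introduced. *)
Ltac def_user := fail.

Ltac def_step :=
  lazymatch goal with
  | |- term (fun _ => ?m) => apply (term_const m)
  | |- term (fun e => e ?k) => apply (term_entry k)
  | |- term _ =>
      first [ def_user | assumption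
            | lazymatch goal with
              | H : term1 ?F |- term (fun e => ?F (@?t e)) => apply (H t)
              end
            | apply term_weaken; assumption ]
  | |- D1 (fun e => @?P e /\ @?Q e) => apply (D1_and P Q)
  | |- D1 (fun e => @?P e \/ @?Q e) => apply (D1_or P Q)
  | |- D1 (fun e => @?P e <-> @?Q e) => apply (D1_iff P Q)
  | |- D1 (fun e => ~ @?P e) => apply (D1_not P)
  | |- D1 (fun e => @?t e = @?u e) => apply (D1_eq t u)
  | |- D1 (fun e => @?t e ∈ @?u e) => apply (D1_mem t u)
  | |- D1 (fun e => @?t e ⊆ @?u e) => apply (D1_subset t u)
  | |- D1 (fun e => forall d, d ∈ @?t e -> @?P e d) => apply (D1_ball P t)
  | |- D1 (fun e => exists d, d ∈ @?t e /\ @?P e d) => apply (D1_bex P t)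
  | |- D1 (fun e => @?P e -> @?Q e) => apply (D1_imp P Q)
  | |- D1 _ => first [ def_user | assumption ]
  | |- S1 (fun e => @?P e /\ @?Q e) => apply (S1_and P Q)
  | |- S1 (fun e => @?P e \/ @?Q e) => apply (S1_or P Q)
  | |- S1 (fun e => forall d, d ∈ @?t e -> @?P e d) => apply (S1_ball P t)
  | |- S1 (fun e => exists d, @?P e d) => apply (S1_ex P)
  | K : S1 (fun e => ?P (e 0)) |- S1 (fun e => ?P (@?t e)) => apply (S1_intro P t K)
  | |- S1 _ => first [ assumption | apply S1_D1 ]
  end; cbv beta.

Ltac def := cbv beta; repeat def_step.

(** * Comprehension, collection and induction for definable predicates *)

Lemma S1_collection (R : M -> M -> Prop) a :
  S1 (fun e => R (e 0) (e 1)) -> (forall u, u ∈ a -> exists v, R v u) ->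
  exists y, forall u, u ∈ a -> exists v, v ∈ y /\ R v u.
Proof.
  intros (Q & DQ & HQ) Ha.
  assert (HR : forall v u, R v u <-> exists w, Q w (scons v (scons u (fun _ => point)))).
  { intros v u. apply (HQ (scons v (scons u (fun _ => point)))). }
  destruct (D0_collection (fun s u => exists v, v ∈ s /\ exists w, w ∈ s /\
              Q w (scons v (scons u (fun _ => point))))) with (a := a) as [Y HY].
  - do 2 (apply D0_bex; [apply is_var_entry |]).
    refine (D0_ext _ _ _ (D0_subst _ (fun k => match k with 0 => inl 0 | 1 => inl 1
              | 2 => inl 3 | _ => inr point end) DQ)).
    intros e. cbn.
    same_env k. destruct k as [| [| k]]; reflexivity.
  - intros u Hu. destruct (Ha u Hu) as [v Hv]. apply HR in Hv as [w Hw].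
    exists (upair v w), v. split; [apply in_upair; auto |].
    exists w. split; [apply in_upair; auto | exact Hw].
  - exists (Un Y). intros u Hu. destruct (HY u Hu) as (s & Hs & v & Hv & w & _ & Hw).
    exists v. split; [apply in_Un; eauto | apply HR; eauto].
Qed.

(** Collection bounds the witnesses on both sides of a Delta_1 predicate, which
    reduces its separation to the Delta_0 case. *)
Lemma in_compr a P :
  D1 (fun e => P (e 0)) -> forall x, x ∈ compr a P <-> x ∈ a /\ P x.
Proof.
  intros [(Q & DQ & HQ) (N & DN & HN)]. apply in_the_set.
  set (c := fun _ : nat => point).
  destruct (D0_collection (fun w x => Q w (scons x c) \/ N w (scons x c)))
    with (a := a) as [W HW].
  - apply (D0_ext (fun e => ~ Q (e 0) (scons (e 1) c) -> N (e 0) (scons (e 1) c))).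
    { intros e. tauto. }
    apply D0_imp; [apply D0_not |];
      [refine (D0_ext _ _ _ (D0_subst _ (fun k => match k with 0 => inl 0 | 1 => inl 1
              | _ => inr point end) DQ))
      |refine (D0_ext _ _ _ (D0_subst _ (fun k => match k with 0 => inl 0 | 1 => inl 1
              | _ => inr point end) DN))];
      intros e; cbn;
      same_env k; now destruct k.
  - intros x _. destruct (classic (P x)) as [Hx | Hx].
    + apply (HQ (scons x c)) in Hx as [w Hw]. eauto.
    + apply (HN (scons x c)) in Hx as [w Hw]. eauto.
  - destruct (D0_separation (fun x => exists w, w ∈ W /\ Q w (scons x c))) with (a := a)
      as [b Hb].
    { apply D0_bex; [apply is_var_const |].
      refine (D0_ext _ _ _ (D0_subst _ (fun k => match k with 0 => inl 0 | 1 => inl 1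
              | _ => inr point end) DQ)).
      intros e; cbn.
      same_env k; now destruct k. }
    exists b. intros x. rewrite Hb. split; intros [Hx H]; (split; [exact Hx |]).
    + destruct H as (w & _ & Hw). apply (HQ (scons x c)). eauto.
    + destruct (HW x Hx) as (w & Hw & [K | K]); [eauto |].
      exfalso. apply (proj2 (HN (scons x c))); eauto.
Qed.

Lemma in_rep a F :
  term (fun e => F (e 0)) -> forall y, y ∈ rep a F <-> exists x, x ∈ a /\ y = F x.
Proof.
  intros HF. apply in_the_set.
  destruct (S1_collection (fun v u => v = F u) a HF) as [Y HY]; [eauto |].
  exists (compr Y (fun y => exists x, x ∈ a /\ y = F x)). intros y.
  rewrite in_compr.
  - split; [tauto |]. intros (x & Hx & ->). split; [| eauto].
    destruct (HY x Hx) as (v & Hv & ->). exact Hv.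
  - def.
Qed.

(** Foundation for Pi_1 classes is induction for Sigma_1 predicates. *)
Lemma S1_induction (P : M -> Prop) :
  S1 (fun e => P (e 0)) -> (forall x, (forall z, z ∈ x -> P z) -> P x) -> forall x, P x.
Proof.
  intros (Q & DQ & HQ) IH x. apply NNPP. intros Nx.
  assert (HP : forall x, P x <-> exists w, Q w (scons x (fun _ => point))).
  { intros z. apply (HQ (scons z (fun _ => point))). }
  destruct (D0_binary (fun w x => ~ Q w (scons x (fun _ => point)))) as (p & c & Dp & Hp).
  { apply D0_not.
    refine (D0_ext _ _ _ (D0_subst _ (fun k => match k with 0 => inl 0 | 1 => inl 1
              | _ => inr point end) DQ)).
    intros e; cbn.
    same_env k; now destruct k. }
  assert (K : forall z, sat E (scons z c) (All p) <-> ~ P z).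
  { intros z. rewrite HP. split.
    - intros H [w Hw]. exact (proj1 (Hp w z) (H w) Hw).
    - intros H w. apply Hp. eauto. }
  assert (D : PiP_syn 1 (All p)) by now repeat constructor.
  assert (H := HM _ (KPP_found D) c).
  assert (H1 : sat E c (Ex (All p))) by (apply sat_Ex; exists x; now apply K).
  apply H, sat_Ex in H1 as [y Hy]. apply sat_And in Hy as [Hy1 Hy2].
  apply K in Hy1. apply Hy1, IH. intros z Hz. specialize (Hy2 z Hz).
  apply NNPP. intros Nz. apply Hy2. apply sat_ren.
  rewrite scons_comp_up. apply K, Nz.
Qed.

(** * Definability of the basic operations *)

Lemma term_Un : term1 Un.
Proof.
  apply term1_graph.
  apply (S1_ext (fun e => (forall z, z ∈ e 0 -> exists y, y ∈ e 1 /\ z ∈ y) /\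
                          (forall y, y ∈ e 1 -> forall z, z ∈ y -> z ∈ e 0))); [| def].
  intros e. split.
  - intros [H1 H2]. apply extensionality_sets. intros z. rewrite in_Un.
    split; [apply H1 | intros (y & Hy & Hz); exact (H2 y Hy z Hz)].
  - intros ->. split; [intros z; apply in_Un | intros y Hy z Hz; apply in_Un; eauto].
Qed.

Lemma term_Pw : term1 Pw.
Proof.
  apply term1_graph.
  apply (S1_ext (fun e => (forall z, z ∈ e 0 -> forall y, y ∈ z -> y ∈ e 1) /\
                          (forall z, z ⊆ e 1 -> z ∈ e 0))).
  - intros e. split.
    + intros [H1 H2]. apply extensionality_sets. intros z. rewrite in_Pw.
      exact (conj (H1 z) (H2 z)).
    + intros ->. split; [intros z; apply in_Pw | intros z; apply in_Pw].
  - apply S1_D0. repeat D0_step.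
Qed.

Lemma term_upair t u : term t -> term u -> term (fun e => upair (t e) (u e)).
Proof.
  apply term2_graph.
  apply (S1_ext (fun e => (forall z, z ∈ e 0 -> z = e 1 \/ z = e 2) /\
                          e 1 ∈ e 0 /\ e 2 ∈ e 0)); [| def].
  intros e. split.
  - intros (H1 & H2 & H3). apply extensionality_sets. intros z. rewrite in_upair.
    split; [apply H1 | intros [-> | ->]; assumption].
  - intros ->. rewrite !in_upair. split; [intros z; apply in_upair | auto].
Qed.

Lemma term_compr (P : (nat -> M) -> M -> Prop) t :
  term t -> D1 (fun e => P (fun k => e (S k)) (e 0)) ->
  term (fun e => compr (t e) (P e)).
Proof.
  intros Ht HP. apply (term_let (fun e a => compr a (P e))); [| exact Ht].
  apply term_graph.
  assert (HP' : forall i j, D1 (fun e => P (fun k => e (j + k)) (e i))).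
  { intros i j. exact (D1_subst _ (shift i j) HP). }
  apply (S1_ext (fun e =>
    (forall z, z ∈ e 0 -> z ∈ e 1 /\ P (fun k => e (S (S k))) z) /\
    (forall z, z ∈ e 1 -> P (fun k => e (S (S k))) z -> z ∈ e 0))).
  - intros e.
    assert (K := fun a => in_compr a (P (fun k => e (S (S k))))
       (D1_subst _ (fun k => match k with 0 => inl 0 | S k => inr (e (S (S k))) end) HP)).
    split.
    + intros [H1 H2]. apply extensionality_sets. intros z. rewrite K.
      split; [apply H1 | intros [Hz Pz]; exact (H2 z Hz Pz)].
    + intros ->. split; intros z; rewrite K; tauto.
  - def; apply (HP' 0 3).
Qed.

Lemma term_rep (F : (nat -> M) -> M -> M) t :
  term t -> term (fun e => F (fun k => e (S k)) (e 0)) ->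
  term (fun e => rep (t e) (F e)).
Proof.
  intros Ht HF. apply (term_let (fun e a => rep a (F e))); [| exact Ht].
  apply term_graph.
  assert (HF' : forall i j, term (fun e => F (fun k => e (j + k)) (e i))).
  { intros i j. exact (S1_subst _ (fun k => match k with 0 => inl 0
      | 1 => inl (S i) | S (S k) => inl (S (j + k)) end) HF). }
  apply (S1_ext (fun e =>
    (forall z, z ∈ e 0 -> exists x, x ∈ e 1 /\ z = F (fun k => e (S (S k))) x) /\
    (forall x, x ∈ e 1 -> F (fun k => e (S (S k))) x ∈ e 0))).
  - intros e.
    assert (K := fun a => in_rep a (F (fun k => e (S (S k))))
       (S1_subst _ (fun k => match k with 0 => inl 0 | 1 => inl 1
          | S (S k) => inr (e (S (S k))) end) HF)).
    split.
    + intros [H1 H2]. apply extensionality_sets. intros z. rewrite K.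
      split; [apply H1 | intros (x & Hx & ->); auto].
    + intros ->. split; [intros z; apply K | intros x Hx; apply K; eauto].
  - def; [apply (HF' 0 4) | apply (HF' 0 3)].
Qed.

Definition sing (a : M) : M := upair a a.
Definition cup (a b : M) : M := Un (upair a b).
Definition op (x y : M) : M := upair (upair x x) (upair x y).
Definition fst' (z : M) : M :=
  Un (compr (Un z) (fun x => exists y, y ∈ Un z /\ z = op x y)).
Definition snd' (z : M) : M :=
  Un (compr (Un z) (fun y => exists x, x ∈ Un z /\ z = op x y)).

(** The value at [x] of a function [f] given by its graph. *)
Definition app (f x : M) : M := Un (compr (Un (Un f)) (fun v => op x v ∈ f)).

(** The restriction to [a] of a function on [M], as an element of [M]. *)
Definition graph (F : M -> M) (a : M) : M := rep a (fun x => op x (F x)).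

Ltac def_sets :=
  lazymatch goal with
  | |- term (fun e => Un (@?t e)) => apply (term_Un t)
  | |- term (fun e => Pw (@?t e)) => apply (term_Pw t)
  | |- term (fun e => upair (@?t e) (@?u e)) => apply (term_upair t u)
  | |- term (fun e => compr (@?t e) (@?P e)) => apply (term_compr P t)
  | |- term (fun e => rep (@?t e) (@?F e)) => apply (term_rep F t)
  end.
Ltac def_user ::= def_sets.

Lemma term_op t u : term t -> term u -> term (fun e => op (t e) (u e)).
Proof. apply term2_intro. unfold op. def. Qed.

Lemma term_cup t u : term t -> term u -> term (fun e => cup (t e) (u e)).
Proof. apply term2_intro. unfold cup. def. Qed.

Lemma term_sing : term1 sing.
Proof. apply term1_intro. unfold sing. def. Qed.

Ltac def_unions :=
  lazymatch goal with
  | |- term (fun e => op (@?t e) (@?u e)) => apply (term_op t u)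
  | |- term (fun e => cup (@?t e) (@?u e)) => apply (term_cup t u)
  | |- term (fun e => sing (@?t e)) => apply (term_sing t)
  end.
Ltac def_user ::= first [ def_sets | def_unions ].

Lemma term_fst : term1 fst'.
Proof. apply term1_intro. unfold fst'. def. Qed.

Lemma term_snd : term1 snd'.
Proof. apply term1_intro. unfold snd'. def. Qed.

Lemma term_app t u : term t -> term u -> term (fun e => app (t e) (u e)).
Proof. apply term2_intro. unfold app. def. Qed.

Ltac def_pairs :=
  lazymatch goal with
  | |- term (fun e => fst' (@?t e)) => apply (term_fst t)
  | |- term (fun e => snd' (@?t e)) => apply (term_snd t)
  | |- term (fun e => app (@?t e) (@?u e)) => apply (term_app t u)
  end.
Ltac def_user ::= first [ def_sets | def_unions | def_pairs ].

Lemma in_sing a x : x ∈ sing a <-> x = a.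
Proof. unfold sing. rewrite in_upair. tauto. Qed.

Lemma in_cup a b x : x ∈ cup a b <-> x ∈ a \/ x ∈ b.
Proof.
  unfold cup. rewrite in_Un. split.
  - intros (y & Hy & Hx). apply in_upair in Hy as [-> | ->]; auto.
  - intros [H | H]; [exists a | exists b]; (split; [apply in_upair; auto | exact H]).
Qed.

Lemma unordered_pair_upair z x y : unordered_pair E z x y <-> z = upair x y.
Proof.
  unfold unordered_pair. split.
  - intros H. apply extensionality_sets. intros w. now rewrite H, in_upair.
  - intros -> w. apply in_upair.
Qed.

Lemma ordered_pair_op p x y : ordered_pair E p x y <-> p = op x y.
Proof.
  unfold ordered_pair, op. setoid_rewrite unordered_pair_upair. split.
  - intros H. apply extensionality_sets. intros w. now rewrite H, in_upair.
  - intros -> w. apply in_upair.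
Qed.

Lemma upair_inj_r a b c : upair a b = upair a c -> b = c.
Proof.
  intros H.
  assert (Hb : b ∈ upair a c) by (rewrite <- H; apply in_upair; auto).
  assert (Hc : c ∈ upair a b) by (rewrite H; apply in_upair; auto).
  apply in_upair in Hb as [-> | ->]; [| reflexivity].
  apply in_upair in Hc as [-> | ->]; reflexivity.
Qed.

Lemma op_inj x y x' y' : op x y = op x' y' -> x = x' /\ y = y'.
Proof.
  intros H.
  assert (Hx : x = x').
  { assert (K : upair x x ∈ op x' y') by (rewrite <- H; apply in_upair; auto).
    assert (L : x' ∈ upair x x).
    { apply in_upair in K as [-> | ->]; apply in_upair; auto. }
    now apply in_upair in L as [-> | ->]. }
  subst x'. split; [reflexivity |]. apply (upair_inj_r x), (upair_inj_r (upair x x)), H.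
Qed.

Lemma in_Un_op x y z : z ∈ Un (op x y) <-> z = x \/ z = y.
Proof.
  rewrite in_Un. split.
  - intros (w & Hw & Hz). apply in_upair in Hw as [-> | ->]; apply in_upair in Hz; tauto.
  - intros H. exists (upair x y). split; apply in_upair; auto.
Qed.

Lemma Un_single P b : (forall x, x ∈ P <-> x = b) -> Un P = b.
Proof.
  intros H. apply extensionality_sets. intros z. rewrite in_Un. split.
  - intros (y & Hy & Hz). apply H in Hy. now subst y.
  - intros Hz. exists b. split; [now apply H | exact Hz].
Qed.

Lemma fst_op x y : fst' (op x y) = x.
Proof.
  apply Un_single. intros z. rewrite in_compr by def. split.
  - intros (_ & y' & _ & H). symmetry. apply (op_inj _ _ _ _ H).
  - intros ->. rewrite in_Un_op. split; [auto |].
    exists y. rewrite in_Un_op. auto.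
Qed.

Lemma snd_op x y : snd' (op x y) = y.
Proof.
  apply Un_single. intros z. rewrite in_compr by def. split.
  - intros (_ & y' & _ & H). symmetry. apply (op_inj _ _ _ _ H).
  - intros ->. rewrite in_Un_op. split; [auto |].
    exists x. rewrite in_Un_op. auto.
Qed.

Lemma op_in_field f x y : op x y ∈ f -> x ∈ Un (Un f) /\ y ∈ Un (Un f).
Proof.
  intros H.
  split; apply in_Un; exists (upair x y); (split; [| apply in_upair; auto]);
    apply in_Un; exists (op x y); (split; [exact H | apply in_upair; auto]).
Qed.

Lemma app_eq f x v : op x v ∈ f -> (forall v', op x v' ∈ f -> v' = v) -> app f x = v.
Proof.
  intros Hv Hu. apply Un_single. intros w. rewrite in_compr by def. split.
  - intros [_ H]. auto.
  - intros ->. split; [apply (op_in_field _ _ _ Hv) | exact Hv].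
Qed.

Lemma in_graph F a p :
  term1 F -> p ∈ graph F a <-> exists x, x ∈ a /\ p = op x (F x).
Proof. intros HF. unfold graph. rewrite in_rep by def. reflexivity. Qed.

Lemma app_graph F a x : term1 F -> x ∈ a -> app (graph F a) x = F x.
Proof.
  intros HF Hx. apply app_eq.
  - apply in_graph; eauto.
  - intros v Hv. apply in_graph in Hv as (z & _ & H); [| exact HF].
    apply op_inj in H as [<- ->]. reflexivity.
Qed.

(** * Recursion along a set-like relation *)

Section Recursion.

(** [pre x] is the set of predecessors of [x]. *)
Variables (pre : M -> M) (G : M -> M -> M).
Hypothesis Hpre : term1 pre.
Hypothesis HG : forall t u, term t -> term u -> term (fun e => G (t e) (u e)).
Hypothesis pre_induction : forall P : M -> Prop,
  S1 (fun e => P (e 0)) -> (forall x, (forall z, z ∈ pre x -> P z) -> P x) ->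
  forall x, P x.

Definition restr (f a : M) : M :=
  compr f (fun q => exists z, z ∈ a /\ exists v, v ∈ Un (Un f) /\ q = op z v).

(** The approximations of the recursive function: partial solutions whose
    domain is closed under predecessors.  The quantifiers are bounded by the
    field of [f], so that this is a Delta_1 predicate. *)
Definition approx (f : M) : Prop :=
  forall q, q ∈ f -> exists x, x ∈ Un (Un f) /\ exists v, v ∈ Un (Un f) /\
    q = op x v /\ (forall z, z ∈ pre x -> exists u, u ∈ Un (Un f) /\ op z u ∈ f) /\
    v = G x (restr f (pre x)).

Lemma term_restr t u : term t -> term u -> term (fun e => restr (t e) (u e)).
Proof. apply term2_intro. unfold restr. def. Qed.

Lemma D1_approx t : term t -> D1 (fun e => approx (t e)).
Proof.
  apply D1_intro. unfold approx.
  repeat first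
    [ lazymatch goal with
      | |- term (fun e => restr (@?t e) (@?u e)) => apply (term_restr t u)
      | |- term (fun e => G (@?t e) (@?u e)) => apply (HG t u)
      end
    | def_step ].
Qed.

Ltac def_rec := cbv beta; repeat first [ def_step | apply D1_approx ].

Lemma in_restr f a q :
  q ∈ restr f a <-> q ∈ f /\ exists z v, z ∈ a /\ q = op z v.
Proof.
  unfold restr. rewrite in_compr by def. split.
  - intros (Hq & z & Hz & v & _ & ->). eauto.
  - intros (Hq & z & v & Hz & ->). split; [exact Hq |]. exists z. split; [exact Hz |].
    exists v. split; [apply (op_in_field _ _ _ Hq) | reflexivity].
Qed.

Lemma approx_op f x v :
  approx f -> op x v ∈ f ->
  (forall z, z ∈ pre x -> exists u, op z u ∈ f) /\ v = G x (restr f (pre x)).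
Proof.
  intros Hf H. destruct (Hf _ H) as (x' & _ & v' & _ & Hq & Hz & Hv).
  apply op_inj in Hq as [<- <-]. split; [| exact Hv].
  intros z Hz'. destruct (Hz z Hz') as (u & _ & Hu). eauto.
Qed.

Lemma approx_intro f :
  (forall q, q ∈ f -> exists x v, q = op x v /\
    (forall z, z ∈ pre x -> exists u, op z u ∈ f) /\ v = G x (restr f (pre x))) ->
  approx f.
Proof.
  intros H q Hq. destruct (H q Hq) as (x & v & -> & Hz & Hv).
  apply op_in_field in Hq as [Hx Hv'].
  exists x. split; [exact Hx |]. exists v. split; [exact Hv' |].
  split; [reflexivity |]. split; [| exact Hv].
  intros z Hz'. destruct (Hz z Hz') as [u Hu]. exists u.
  split; [apply (op_in_field _ _ _ Hu) | exact Hu].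
Qed.

Lemma restr_agree f g a :
  (forall z, z ∈ a -> exists u, op z u ∈ f) ->
  (forall z, z ∈ a -> exists u, op z u ∈ g) ->
  (forall z u v, z ∈ a -> op z u ∈ f -> op z v ∈ g -> u = v) ->
  restr f a = restr g a.
Proof.
  intros Hf Hg H. apply extensionality_sets. intros q. rewrite !in_restr.
  split; intros (Hq & z & v & Hz & ->); (split; [| eauto]).
  - destruct (Hg z Hz) as [u Hu]. now rewrite (H z v u Hz Hq Hu).
  - destruct (Hf z Hz) as [u Hu]. now rewrite <- (H z u v Hz Hu Hq).
Qed.

Lemma approx_unique f g x u v :
  approx f -> approx g -> op x u ∈ f -> op x v ∈ g -> u = v.
Proof.
  intros Hf Hg. revert x u v.
  assert (K : forall x, forall u, u ∈ Un (Un f) -> forall v, v ∈ Un (Un g) ->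
                op x u ∈ f -> op x v ∈ g -> u = v).
  { refine (pre_induction _ _ _); [def |].
    intros x IH u _ v _ Hu Hv.
    destruct (approx_op _ _ _ Hf Hu) as [Df ->].
    destruct (approx_op _ _ _ Hg Hv) as [Dg ->].
    f_equal. apply restr_agree; [exact Df | exact Dg |].
    intros z u v Hz Hu' Hv'.
    apply (IH z Hz); auto; eapply op_in_field; eassumption. }
  intros x u v Hu Hv. apply (K x); auto; eapply op_in_field; eassumption.
Qed.

(** Collection gathers approximations for the predecessors of [x].  They agree
    where they overlap, so their union is an approximation, and it is extended
    by a value at [x]. *)
Lemma approx_exists x : exists f, approx f /\ exists v, v ∈ Un (Un f) /\ op x v ∈ f.
Proof.
  revert x. refine (pre_induction _ _ _).
  { def_rec. }
  intros x IH.
  destruct (S1_collection (fun f z => approx f /\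
              exists v, v ∈ Un (Un f) /\ op z v ∈ f) (pre x)) as [W HW]; [| exact IH |].
  { def_rec. }
  set (F := Un (compr W approx)).
  assert (inF : forall q, q ∈ F <-> exists f, f ∈ W /\ approx f /\ q ∈ f).
  { intros q. unfold F. rewrite in_Un. split.
    - intros (f & Hf & Hq). apply in_compr in Hf as [Hf Af];
        [eauto | def_rec].
    - intros (f & Hf & Af & Hq). exists f. split; [| exact Hq].
      apply in_compr; [def_rec | auto]. }
  assert (HF : approx F).
  { apply approx_intro. intros q Hq. apply inF in Hq as (f & Hf & Af & Hq).
    destruct (Af q Hq) as (z & _ & v & _ & -> & _).
    destruct (approx_op _ _ _ Af Hq) as [Dz Hv].
    assert (DF : forall w, w ∈ pre z -> exists u, op w u ∈ F).
    { intros w Hw. destruct (Dz w Hw) as [u Hu]. exists u. apply inF; eauto. }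
    exists z, v. split; [reflexivity |]. split; [exact DF |].
    rewrite Hv. f_equal. apply restr_agree; [exact Dz | exact DF |].
    intros w u u' _ Hu Hu'. apply inF in Hu' as (g & Hg & Ag & Hu').
    exact (approx_unique f g w u u' Af Ag Hu Hu'). }
  assert (DF : forall z, z ∈ pre x -> exists u, op z u ∈ F).
  { intros z Hz. destruct (HW z Hz) as (f & Hf & Af & u & _ & Hu).
    exists u. apply inF; eauto. }
  destruct (classic (exists v, op x v ∈ F)) as [[v Hv] | Nx].
  { exists F. split; [exact HF |]. exists v. split; [eapply op_in_field |]; eassumption. }
  set (p := op x (G x (restr F (pre x)))). set (F' := cup F (sing p)).
  assert (R : forall z, (forall w, w ∈ pre z -> exists u, op w u ∈ F) ->
                        restr F' (pre z) = restr F (pre z)).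
  { intros z Hz. apply restr_agree; [| exact Hz |].
    - intros w Hw. destruct (Hz w Hw) as [u Hu]. exists u. apply in_cup. auto.
    - intros w u v Hw Hu Hv. apply in_cup in Hu as [Hu | Hu].
      + exact (approx_unique F F w u v HF HF Hu Hv).
      + apply in_sing, op_inj in Hu as [-> _]. exfalso. eauto. }
  exists F'. split.
  - apply approx_intro. intros q Hq. apply in_cup in Hq as [Hq | Hq].
    + destruct (HF q Hq) as (z & _ & v & _ & -> & _).
      destruct (approx_op _ _ _ HF Hq) as [Dz Hv].
      exists z, v. split; [reflexivity |]. split; [| now rewrite R].
      intros w Hw. destruct (Dz w Hw) as [u Hu]. exists u. apply in_cup. auto.
    + apply in_sing in Hq. subst q. exists x, (G x (restr F (pre x))).
      split; [reflexivity |]. split; [| now rewrite R].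
      intros w Hw. destruct (DF w Hw) as [u Hu]. exists u. apply in_cup. auto.
  - assert (Hp : p ∈ F') by (apply in_cup; right; now apply in_sing).
    exists (G x (restr F (pre x))). split; [eapply op_in_field |]; exact Hp.
Qed.

(** Being covered by an approximation is a Sigma_1 property, so induction for
    such properties along [pre] is all that recursion along [pre] takes. *)
Theorem recursion :
  exists F, term1 F /\ forall x, F x = G x (graph F (pre x)).
Proof.
  assert (ex : forall x, exists v, exists f, approx f /\ op x v ∈ f).
  { intros x. destruct (approx_exists x) as (f & Hf & v & _ & Hv). eauto. }
  set (F := fun x => epsilon (inhabits point) (fun v => exists f, approx f /\ op x v ∈ f)).
  assert (F_spec : forall x, exists f, approx f /\ op x (F x) ∈ f).
  { intros x. exact (epsilon_spec (inhabits point) _ (ex x)). }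
  assert (HF : term1 F).
  { apply term1_graph.
    apply (S1_ext (fun e => exists f, approx f /\ op (e 1) (e 0) ∈ f)).
    - intros e. split; [| intros ->; apply F_spec].
      intros (f & Hf & H). destruct (F_spec (e 1)) as (g & Hg & K).
      exact (approx_unique f g _ _ _ Hf Hg H K).
    - def_rec. }
  exists F. split; [exact HF |]. intros x.
  destruct (F_spec x) as (f & Hf & H). destruct (approx_op _ _ _ Hf H) as [D ->].
  f_equal. apply extensionality_sets. intros q. rewrite in_restr, in_graph by exact HF.
  split.
  - intros (Hq & z & v & Hz & ->). exists z. split; [exact Hz |]. f_equal.
    destruct (F_spec z) as (g & Hg & K). exact (approx_unique f g _ _ _ Hf Hg Hq K).
  - intros (z & Hz & ->). destruct (D z Hz) as [u Hu].
    destruct (F_spec z) as (g & Hg & K).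
    rewrite <- (approx_unique f g _ _ _ Hf Hg Hu K). eauto.
Qed.

End Recursion.

Theorem mem_recursion G :
  (forall t u, term t -> term u -> term (fun e => G (t e) (u e))) ->
  exists F, term1 F /\ forall x, F x = G x (graph F x).
Proof.
  intros HG. apply (recursion (fun x => x)); [intros t Ht; exact Ht | exact HG |].
  exact S1_induction.
Qed.

Definition solution (G : M -> M -> M)
    (HG : forall t u, term t -> term u -> term (fun e => G (t e) (u e))) : M -> M :=
  proj1_sig (constructive_indefinite_description _ (mem_recursion G HG)).

Lemma solution_spec G HG :
  term1 (solution G HG) /\ forall x, solution G HG x = G x (graph (solution G HG) x).
Proof. exact (proj2_sig (constructive_indefinite_description _ (mem_recursion G HG))). Qed.

(** * Transitive closure, rank and the cumulative hierarchy *)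

Definition tc_step (x f : M) : M := cup x (Un (rep x (fun z => app f z))).
Definition rk_step (x f : M) : M := Un (rep x (fun z => cup (app f z) (sing (app f z)))).
Definition level_step (x f : M) : M := Pw (Un (rep x (fun z => app f z))).

Lemma term_tc_step t u : term t -> term u -> term (fun e => tc_step (t e) (u e)).
Proof. apply term2_intro. unfold tc_step. def. Qed.

Lemma term_rk_step t u : term t -> term u -> term (fun e => rk_step (t e) (u e)).
Proof. apply term2_intro. unfold rk_step. def. Qed.

Lemma term_level_step t u : term t -> term u -> term (fun e => level_step (t e) (u e)).
Proof. apply term2_intro. unfold level_step. def. Qed.

Definition tc : M -> M := solution tc_step term_tc_step.
Definition rk : M -> M := solution rk_step term_rk_step.

(** [level y] is the set of the sets of rank at most the rank of [y].  This
    indexing of the cumulative hierarchy by sets turns comparisons of ranks into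
    memberships, see [rank_le_level]. *)
Definition level : M -> M := solution level_step term_level_step.

Lemma term_tc : term1 tc.
Proof. apply solution_spec. Qed.

Lemma term_rk : term1 rk.
Proof. apply solution_spec. Qed.

Lemma term_level : term1 level.
Proof. apply solution_spec. Qed.

Ltac def_ranks :=
  lazymatch goal with
  | |- term (fun e => tc (@?t e)) => apply (term_tc t)
  | |- term (fun e => rk (@?t e)) => apply (term_rk t)
  | |- term (fun e => level (@?t e)) => apply (term_level t)
  end.
Ltac def_user ::= first [ def_sets | def_unions | def_pairs | def_ranks ].

Lemma in_tc x w : w ∈ tc x <-> w ∈ x \/ exists z, z ∈ x /\ w ∈ tc z.
Proof.
  unfold tc at 1. rewrite (proj2 (solution_spec _ _)). fold tc. unfold tc_step.
  rewrite in_cup, in_Un.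
  assert (K : (exists y, y ∈ rep x (fun z => app (graph tc x) z) /\ w ∈ y) <->
              exists z, z ∈ x /\ w ∈ tc z); [| rewrite K; reflexivity].
  split.
  - intros (y & Hy & Hw). apply in_rep in Hy as (z & Hz & ->); [| def].
    rewrite app_graph in Hw; eauto using term_tc.
  - intros (z & Hz & Hw). exists (tc z). split; [| exact Hw].
    apply in_rep; [def |]. exists z. rewrite app_graph; auto using term_tc.
Qed.

Lemma in_rk x w : w ∈ rk x <-> exists z, z ∈ x /\ (w ∈ rk z \/ w = rk z).
Proof.
  unfold rk at 1. rewrite (proj2 (solution_spec _ _)). fold rk. unfold rk_step.
  rewrite in_Un. split.
  - intros (y & Hy & Hw). apply in_rep in Hy as (z & Hz & ->); [| def].
    rewrite app_graph in Hw by auto using term_rk.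
    apply in_cup in Hw. rewrite in_sing in Hw. eauto.
  - intros (z & Hz & Hw). exists (cup (rk z) (sing (rk z))).
    split; [| rewrite in_cup, in_sing; exact Hw].
    apply in_rep; [def |]. exists z. rewrite app_graph; auto using term_rk.
Qed.

Lemma in_level y x : x ∈ level y <-> forall w, w ∈ x -> exists z, z ∈ y /\ w ∈ level z.
Proof.
  unfold level at 1. rewrite (proj2 (solution_spec _ _)). fold level. unfold level_step.
  rewrite in_Pw. unfold subset.
  split; intros Hx w Hw; specialize (Hx w Hw).
  - apply in_Un in Hx as (u & Hu & Hw'). apply in_rep in Hu as (z & Hz & ->); [| def].
    rewrite app_graph in Hw'; eauto using term_level.
  - destruct Hx as (z & Hz & Hw'). apply in_Un. exists (level z). split; [| exact Hw'].
    apply in_rep; [def |]. exists z. rewrite app_graph; auto using term_level.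
Qed.

Lemma mem_irrefl x : ~ x ∈ x.
Proof.
  revert x. refine (S1_induction _ _ _); [def |].
  intros x IH Hx. exact (IH x Hx Hx).
Qed.

Lemma tc_transitive x y : y ∈ tc x -> y ⊆ tc x.
Proof.
  revert x y. refine (S1_induction _ _ _); [def |].
  intros x IH y Hy w Hw. apply in_tc. right. apply in_tc in Hy as [Hy | (z & Hz & Hy)].
  - exists y. split; [exact Hy |]. apply in_tc. auto.
  - exists z. split; [exact Hz |]. exact (IH z Hz y Hy w Hw).
Qed.

Lemma minimal_element s x : x ∈ s -> exists y, y ∈ s /\ forall z, z ∈ y -> ~ z ∈ s.
Proof.
  intros Hx. apply NNPP. intros N. revert x Hx.
  refine (S1_induction (fun x => ~ x ∈ s) _ _); [def |].
  intros x IH Hx. apply N. eauto.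
Qed.

(** Under foundation the ordinals are the transitive sets of transitive sets. *)
Definition ord (a : M) : Prop :=
  (forall x, x ∈ a -> x ⊆ a) /\ forall x, x ∈ a -> forall y, y ∈ x -> y ⊆ x.

Lemma D1_ord t : term t -> D1 (fun e => ord (t e)).
Proof. apply D1_intro. unfold ord. def. Qed.

Lemma ord_mem a x : ord a -> x ∈ a -> ord x.
Proof.
  intros [T1 T2] Hx. split; [apply T2, Hx |].
  intros y Hy. exact (T2 y (T1 x Hx y Hy)).
Qed.

Lemma ord_linear a b : ord a -> ord b -> a ∈ b \/ a = b \/ b ∈ a.
Proof.
  intros Ha Hb.
  assert (O : forall c, ord c -> forall x, x ∈ cup c (sing c) -> ord x /\ x ⊆ cup c (sing c)).
  { intros c Hc x Hx. apply in_cup in Hx as [Hx | Hx].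
    - split; [exact (ord_mem _ _ Hc Hx) |]. intros y Hy. apply in_cup. left.
      exact (proj1 Hc x Hx y Hy).
    - apply in_sing in Hx. subst x. split; [exact Hc |]. intros y Hy. apply in_cup. auto. }
  assert (K : forall x, x ∈ cup a (sing a) -> forall y, y ∈ cup b (sing b) ->
                x ∈ y \/ x = y \/ y ∈ x).
  { refine (S1_induction _ _ _); [apply S1_D1; def |]. intros x IHx Hx.
    destruct (O a Ha x Hx) as [Ox Sx].
    refine (S1_induction _ _ _); [apply S1_D1; def |]. intros y IHy Hy.
    destruct (O b Hb y Hy) as [Oy Sy].
    destruct (classic (exists z, z ∈ x /\ (z = y \/ y ∈ z))) as [(z & Hz & [-> | K]) | Nx];
      [auto | right; right; exact (proj1 Ox z Hz y K) |].
    destruct (classic (exists z, z ∈ y /\ (z = x \/ x ∈ z))) as [(z & Hz & [-> | K]) | Ny];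
      [auto | left; exact (proj1 Oy z Hz x K) |].
    right; left. apply extensionality_sets. intros z. split; intros Hz.
    - destruct (IHx z Hz (Sx z Hz) y Hy) as [K | [K | K]]; [exact K | |];
        exfalso; eauto.
    - destruct (IHy z Hz (Sy z Hz)) as [K | [K | K]]; [| | exact K];
        exfalso; eauto. }
  apply K; apply in_cup; right; now apply in_sing.
Qed.

Lemma ord_subset a b : ord a -> ord b -> a ⊆ b -> a ∈ b \/ a = b.
Proof.
  intros Ha Hb S. destruct (ord_linear a b Ha Hb) as [K | [K | K]]; auto.
  exfalso. exact (mem_irrefl b (S b K)).
Qed.

Lemma rk_ord x : ord (rk x).
Proof.
  revert x. refine (S1_induction _ _ _); [apply S1_D1, D1_ord; def |].
  intros x IH. split; intros u Hu.
  - intros w Hw. apply in_rk. apply in_rk in Hu as (z & Hz & Hu). exists z.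
    split; [exact Hz |]. left. destruct Hu as [Hu | ->]; [| exact Hw].
    exact (proj1 (IH z Hz) u Hu w Hw).
  - apply in_rk in Hu as (z & Hz & [Hu | ->]); [exact (proj2 (IH z Hz) u Hu) |].
    exact (proj1 (IH z Hz)).
Qed.

Lemma rk_of_ord a : ord a -> rk a = a.
Proof.
  revert a. refine (S1_induction _ _ _).
  { apply S1_D1. repeat first [apply D1_ord | def_step]. }
  intros a IH Ha. apply extensionality_sets. intros w. rewrite in_rk. split.
  - intros (z & Hz & Hw). rewrite (IH z Hz (ord_mem _ _ Ha Hz)) in Hw.
    destruct Hw as [Hw | ->]; [exact (proj1 Ha z Hz w Hw) | exact Hz].
  - intros Hw. exists w. rewrite (IH w Hw (ord_mem _ _ Ha Hw)). auto.
Qed.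

Lemma ordinal_ord a : ordinal E a <-> ord a.
Proof.
  split.
  - intros (T & _ & Tr & _). split; [exact T |]. intros x Hx y Hy z Hz.
    assert (Hya := T x Hx y Hy). exact (Tr z y x (T y Hya z Hz) Hya Hx Hz Hy).
  - intros Ha. split; [exact (proj1 Ha) |].
    split; [intros x _; apply mem_irrefl |].
    split; [intros x y z _ _ Hz Hxy Hyz; exact (proj2 Ha z Hz y Hyz x Hxy) |].
    split; [intros x y Hx Hy; apply ord_linear; eauto using ord_mem |].
    intros s Hs [x Hx]. destruct (minimal_element s x Hx) as (y & Hy & Hmin).
    exists y. split; [exact Hy |]. intros z Hz.
    destruct (ord_linear y z) as [K | [K | K]];
      [exact (ord_mem _ _ Ha (Hs y Hy)) | exact (ord_mem _ _ Ha (Hs z Hz)) | auto | auto |].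
    exfalso. exact (Hmin z K Hz).
Qed.

Lemma rk_mem x y : x ∈ y -> rk x ∈ rk y.
Proof. intros Hx. apply in_rk. eauto. Qed.

Lemma in_level_rk x y : x ∈ level y <-> rk x ⊆ rk y.
Proof.
  (* The induction hypothesis is needed for elements of [x]; letting it range
     over a transitive set keeps it Delta_1. *)
  set (T := cup (tc x) (sing x)).
  assert (HT : forall z, z ∈ T -> z ⊆ T).
  { intros z Hz w Hw. apply in_cup. left. apply in_cup in Hz as [Hz | Hz].
    - exact (tc_transitive x z Hz w Hw).
    - apply in_sing in Hz. subst z. apply in_tc. auto. }
  assert (K : forall y, forall z, z ∈ T -> (z ∈ level y <-> rk z ⊆ rk y)).
  2:{ apply K, in_cup. right. now apply in_sing. }
  clear y. refine (S1_induction _ _ _); [def |]. intros y IH z Hz. rewrite in_level.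
  split.
  - intros Hw u Hu. apply in_rk in Hu as (w & Hwz & Hu).
    destruct (Hw w Hwz) as (v & Hv & Hwv). apply in_rk. exists v. split; [exact Hv |].
    apply (IH v Hv w (HT z Hz w Hwz)) in Hwv.
    destruct Hu as [Hu | ->]; [left; exact (Hwv u Hu) |].
    exact (ord_subset _ _ (rk_ord w) (rk_ord v) Hwv).
  - intros Hr w Hw. assert (K := Hr _ (rk_mem _ _ Hw)). apply in_rk in K as (v & Hv & K).
    exists v. split; [exact Hv |]. apply (IH v Hv w (HT z Hz w Hw)).
    destruct K as [K | ->]; [exact (proj1 (rk_ord v) _ K) | intros u Hu; exact Hu].
Qed.

Lemma level_refl x : x ∈ level x.
Proof. apply in_level_rk. intros z Hz. exact Hz. Qed.

Lemma level_trans x y z : x ∈ level y -> y ∈ level z -> x ∈ level z.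
Proof. rewrite !in_level_rk. intros K L w Hw. exact (L w (K w Hw)). Qed.

Lemma mem_level x y : x ∈ y -> x ∈ level y.
Proof. intros Hx. apply in_level_rk. exact (proj1 (rk_ord y) _ (rk_mem _ _ Hx)). Qed.

Lemma subset_level x y : x ⊆ y -> x ∈ level y.
Proof.
  intros Hx. apply in_level. intros w Hw. exists w. split; [exact (Hx w Hw) | apply level_refl].
Qed.

Lemma level_total x y : x ∈ level y \/ y ∈ level x.
Proof.
  rewrite !in_level_rk.
  destruct (ord_linear (rk x) (rk y) (rk_ord x) (rk_ord y)) as [K | [-> | K]].
  - left. exact (proj1 (rk_ord y) _ K).
  - left. intros z Hz. exact Hz.
  - right. exact (proj1 (rk_ord x) _ K).
Qed.

Lemma sing_not_in_level x : ~ sing x ∈ level x.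
Proof.
  intros K. apply in_level_rk in K. apply (mem_irrefl (rk x)). apply K, rk_mem.
  now apply in_sing.
Qed.

Lemma maps_to_op f x y : maps_to E f x y <-> op x y ∈ f.
Proof.
  unfold maps_to. split.
  - intros (p & Hp & K). apply ordered_pair_op in K. now subst p.
  - intros K. exists (op x y). split; [exact K | now apply ordered_pair_op].
Qed.

Lemma is_rank_rk x r : is_rank E x r <-> r = rk x.
Proof.
  split.
  - intros (f & t & (Tt & Ff & R) & Hx & Hr). apply maps_to_op in Hr.
    assert (K : forall y, y ∈ t -> forall v, v ∈ Un (Un f) -> op y v ∈ f -> v = rk y).
    { refine (S1_induction _ _ _); [apply S1_D1; def |].
      intros y IH Hy v _ Hv. apply extensionality_sets. intros w.
      rewrite (R y v Hy (proj2 (maps_to_op _ _ _) Hv)), in_rk. split.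
      - intros (z & u & Hz & Hu & Hw). apply maps_to_op in Hu. exists z.
        split; [exact Hz |].
        rewrite <- (IH z Hz (Tt y Hy z Hz) u (proj2 (op_in_field _ _ _ Hu)) Hu). exact Hw.
      - intros (z & Hz & Hw). destruct (proj2 Ff z (Tt y Hy z Hz)) as (u & Hu & _).
        exists z, u. split; [exact Hz |]. split; [exact Hu |]. apply maps_to_op in Hu.
        rewrite (IH z Hz (Tt y Hy z Hz) u (proj2 (op_in_field _ _ _ Hu)) Hu). exact Hw. }
    apply (K x Hx r); [apply (op_in_field _ _ _ Hr) | exact Hr].
  - intros ->. set (t := cup (tc x) (sing x)).
    assert (HT : forall z, z ∈ t -> z ⊆ t).
    { intros z Hz w Hw. apply in_cup. left. apply in_cup in Hz as [Hz | Hz].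
      - exact (tc_transitive x z Hz w Hw).
      - apply in_sing in Hz. subst z. apply in_tc. auto. }
    assert (Hx : x ∈ t) by (apply in_cup; right; now apply in_sing).
    assert (K : forall y v, maps_to E (graph rk t) y v <-> y ∈ t /\ v = rk y).
    { intros y v. rewrite maps_to_op, in_graph by apply term_rk. split.
      - intros (z & Hz & L). apply op_inj in L as [-> ->]. auto.
      - intros [Hy ->]. eauto. }
    exists (graph rk t), t. split; [| split; [exact Hx | now apply K]].
    split; [exact HT |]. split; [split |].
    + intros p Hp. apply in_graph in Hp as (y & Hy & ->); [| apply term_rk].
      exists y, (rk y). split; [exact Hy | now apply ordered_pair_op].
    + intros y Hy. exists (rk y). split; [now apply K |]. intros v Hv. now apply K in Hv.
    + intros y v Hy Hv w. apply K in Hv as [_ ->]. rewrite in_rk. split.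
      * intros (z & Hz & Hw). exists z, (rk z). split; [exact Hz |].
        split; [| exact Hw]. apply K. split; [exact (HT y Hy z Hz) | reflexivity].
      * intros (z & u & Hz & Hu & Hw). apply K in Hu as [_ ->]. eauto.
Qed.

Lemma rank_le_level x y : rank_le E x y <-> x ∈ level y.
Proof.
  rewrite in_level_rk. unfold rank_le. setoid_rewrite is_rank_rk. split.
  - intros (r & s & -> & -> & [K | ->]); [exact (proj1 (rk_ord y) _ K) | intros z Hz; exact Hz].
  - intros K. exists (rk x), (rk y). auto using ord_subset, rk_ord.
Qed.

Lemma rank_lt_rk x a : rank_lt E x a <-> rk x ∈ a.
Proof.
  unfold rank_lt. setoid_rewrite is_rank_rk. split; [intros (r & -> & K) |]; eauto.
Qed.

Lemma rank_lt_level x a : ord a -> rank_lt E x a -> x ∈ level a.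
Proof.
  intros Ha K. apply rank_lt_rk in K. apply in_level_rk. rewrite (rk_of_ord a Ha).
  exact (proj1 Ha _ K).
Qed.

Lemma Acc_rk x : Acc E (rk x) -> Acc E x.
Proof.
  intros K. remember (rk x) as r eqn:Hr. revert x Hr.
  induction K as [r _ IH]. intros x ->. constructor. intros z Hz.
  exact (IH (rk z) (rk_mem _ _ Hz) z eq_refl).
Qed.

Lemma not_Acc_step x : ~ Acc E x -> exists z, z ∈ x /\ ~ Acc E z.
Proof.
  intros N. apply NNPP. intros K. apply N. constructor. intros z Hz.
  apply NNPP. intros Nz. eauto.
Qed.

Lemma nonstandard_ord : nonstandard E -> exists z, ord z /\ ~ Acc E z.
Proof.
  intros N. apply not_all_ex_not in N as [x Hx]. exists (rk x).
  split; [apply rk_ord |]. intros K. exact (Hx (Acc_rk x K)).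
Qed.

(** * From self-embeddings to Sigma_1 separation *)

Section Embedding.

Variable i : M -> M.
Hypothesis i_mem : forall x y, x ∈ y <-> i x ∈ i y.
Hypothesis i_initial : rank_initial E i.

Lemma range_level x n : n ∈ level (i x) -> exists k, i k = n.
Proof. intros K. apply (i_initial x n), rank_le_level, K. Qed.

Lemma i_subset x y : x ⊆ y <-> i x ⊆ i y.
Proof.
  split; intros K z Hz.
  - destruct (range_level x z (mem_level _ _ Hz)) as [k <-].
    apply (proj1 (i_mem k y)), (K k), (proj2 (i_mem k x)), Hz.
  - apply (proj2 (i_mem z y)), (K (i z)), (proj1 (i_mem z x)), Hz.
Qed.

Lemma i_bounded_forall (B : M -> M -> Prop) (P Q : M -> Prop) y :
  (forall x y, B x y <-> B (i x) (i y)) -> (forall x y, B x y -> x ∈ level y) ->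
  (forall x, P x <-> Q (i x)) ->
  (forall x, B x y -> P x) <-> (forall x, B x (i y) -> Q x).
Proof.
  intros HB HH HP. split; intros K x Hx.
  - destruct (range_level y x (HH _ _ Hx)) as [k <-]. apply HP, K, HB, Hx.
  - apply HP, K. now apply HB in Hx.
Qed.

Lemma i_bounded_exists (B : M -> M -> Prop) (P Q : M -> Prop) y :
  (forall x y, B x y <-> B (i x) (i y)) -> (forall x y, B x y -> x ∈ level y) ->
  (forall x, P x <-> Q (i x)) ->
  (exists x, B x y /\ P x) <-> (exists x, B x (i y) /\ Q x).
Proof.
  intros HB HH HP. split; intros (x & Hx & K).
  - exists (i x). rewrite <- HB, <- HP. auto.
  - destruct (range_level y x (HH _ _ Hx)) as [k <-]. exists k. rewrite HB, HP. auto.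
Qed.

(** Elements and subsets of [i y] have rank at most that of [i y] and are
    therefore in the range of [i], so bounded quantifiers are transferred. *)
Lemma i_Delta0P p : Delta0P p -> forall e, sat E e p <-> sat E (fun k => i (e k)) p.
Proof.
  assert (comm : forall e d, scons (i d) (fun k => i (e k)) = fun k => i (scons d e k)).
  { intros e d. extensionality k. now destruct k. }
  assert (I : forall x y, x = y <-> i x = i y).
  { intros x y. split; [now intros -> |]. intros K. apply extensionality_sets.
    intros z. rewrite (i_mem z x), (i_mem z y), K. reflexivity. }
  intros D. induction D; intros e; cbn [sat].
  - reflexivity.
  - apply I.
  - apply i_mem.
  - rewrite IHD1, IHD2. reflexivity.
  - refine (i_bounded_forall E (fun d => sat E (scons d e) p)
      (fun d => sat E (scons d (fun k => i (e k))) p) (e y) i_mem mem_level _).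
    intros d. rewrite comm. apply IHD.
  - rewrite !sat_Ex. setoid_rewrite sat_And.
    refine (i_bounded_exists E (fun d => sat E (scons d e) p)
      (fun d => sat E (scons d (fun k => i (e k))) p) (e y) i_mem mem_level _).
    intros d. rewrite comm. apply IHD.
  - refine (i_bounded_forall (subset E) (fun d => sat E (scons d e) p)
      (fun d => sat E (scons d (fun k => i (e k))) p) (e y) i_subset subset_level _).
    intros d. rewrite comm. apply IHD.
  - rewrite !sat_Ex. setoid_rewrite sat_And.
    refine (i_bounded_exists (subset E) (fun d => sat E (scons d e) p)
      (fun d => sat E (scons d (fun k => i (e k))) p) (e y) i_subset subset_level _).
    intros d. rewrite comm. apply IHD.
Qed.

Lemma range_bounded : proper i -> exists n, forall x, i x ∈ level n.
Proof.
  intros N. apply not_all_ex_not in N as [n Hn]. exists n. intros x.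
  destruct (level_total (i x) n) as [K | K]; [exact K |].
  exfalso. apply Hn. exact (range_level x n K).
Qed.

End Embedding.

Lemma finite_set_exists (e : nat -> M) N : exists c, forall k, k < N -> e k ∈ c.
Proof.
  induction N as [| N [c Hc]].
  - exists point. lia.
  - exists (cup c (sing (e N))). intros k Hk. apply in_cup.
    destruct (Nat.eq_dec k N) as [-> | K]; [right; now apply in_sing | left; apply Hc; lia].
Qed.

(** An embedding that fixes the parameters moves every witness into [level n],
    where [n] bounds the range, without affecting what it witnesses. *)
Lemma separation_of_embeddings :
  (forall a, ordinal E a -> exists i,
     self_embedding E i /\ proper i /\ rank_initial E i /\ fixes_below E i a) ->
  models E (Separation (SigmaP 1)).
Proof.
  intros Emb _ [p (q & Hq & Hpq)] e.
  inversion Hq as [| m q' Hq' Em Eq]; subst. inversion Hq' as [q'' D |]; subst.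
  assert (Hp : forall x, sat E (scons x e) p <->
                         exists y, sat E (scons y (scons x e)) q').
  { intros x. rewrite <- sat_Ex. apply sat_Iff.
    apply (nd_sound _ _ _ _ _ Hpq HM). intros g []. }
  intros a. apply sat_Ex.
  destruct (sat_finite_support _ E q') as [N HN].
  destruct (finite_set_exists (scons a e) N) as [c Hc].
  (* The extra element makes [a] available even if [N] is 0. *)
  set (c' := cup c (sing a)).
  destruct (Emb (rk c')) as (i & [_ i_mem] & i_proper & i_initial & i_fix).
  { apply ordinal_ord, rk_ord. }
  destruct (range_bounded i i_initial i_proper) as [n Hn].
  assert (fix1 : forall x, rk x ∈ rk c' -> i x = x).
  { intros x Hx. apply i_fix, rank_lt_rk, Hx. }
  assert (fix_a : forall x, x ∈ a -> i x = x).
  { intros x Hx. apply fix1. apply (proj1 (rk_ord c') (rk a)); [| now apply rk_mem].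
    apply rk_mem, in_cup. right. now apply in_sing. }
  assert (fix_e : forall k, S k < N -> i (e k) = e k).
  { intros k Hk. apply fix1, rk_mem, in_cup. left. exact (Hc (S k) Hk). }
  exists (compr a (fun x => exists y, y ∈ level n /\ sat E (scons y (scons x e)) q')).
  intros x. apply sat_Iff. cbn [sat]. rewrite sat_And, sat_ren, scons_comp_up.
  change (x ∈ compr a (fun x => exists y, y ∈ level n /\ sat E (scons y (scons x e)) q') <->
          x ∈ a /\ sat E (scons x e) p).
  rewrite in_compr, Hp.
  - split; intros [Hx (y & Hy)]; (split; [exact Hx |]).
    + exists y. apply Hy.
    + exists (i y). split; [apply Hn |].
      apply (i_Delta0P i i_mem i_initial q' D) in Hy. revert Hy.
      apply HN. intros [| [| k]] Hk; cbn; symmetry;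
        [reflexivity | now apply fix_a | apply fix_e; lia].
  - apply (D1_bex (fun e' y => sat E (scons y (scons (e' 0) e)) q') (fun _ => level n)); [def |].
    apply D1_D0. exists q',
      (fun k => match k with 0 => inl 0 | 1 => inl 1 | S (S k) => inr (e k) end).
    split; [exact D |]. intros e'.
    same_env k. destruct k as [| [| k]]; reflexivity.
Qed.

(** * From Sigma_1 separation to self-embeddings *)

Section Construction.

Hypothesis Sep : models E (Separation (SigmaP 1)).

Lemma S1_separation P a :
  S1 (fun e => P (e 0)) -> exists b, forall x, x ∈ b <-> x ∈ a /\ P x.
Proof.
  intros (Q & DQ & HQ).
  destruct (D0_binary (fun w x => Q w (scons x (fun _ => point)))) as (p & c & Dp & Hp).
  { refine (D0_ext _ _ _ (D0_subst _ (fun k => match k with 0 => inl 0 | 1 => inl 1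
              | _ => inr point end) DQ)).
    intros e; cbn.
    same_env k; now destruct k. }
  assert (D : SigmaP 1 (Ex p)).
  { exists (Ex p). split; [now repeat constructor | apply provable_Iff_refl]. }
  assert (K := Sep _ (Separation_sep _ _ D) c a). apply sat_Ex in K as [b Hb].
  exists b. intros x. specialize (Hb x).
  rewrite sat_Iff, sat_And, sat_ren, scons_comp_up, sat_Ex in Hb.
  rewrite (HQ (scons x (fun _ => point))).
  cbn in Hb. setoid_rewrite Hp in Hb. exact Hb.
Qed.


Definition emp : M := the_set (fun _ => False).

Lemma in_emp x : ~ x ∈ emp.
Proof.
  intros K. apply (in_the_set (fun _ => False)) in K; [exact K |].
  exists (compr point (fun _ => False)). intros y.
  rewrite in_compr; [tauto | apply D1_D0, D0_False].
Qed.

(** Distinct labels for the kinds of information recorded in a type. *)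
Fixpoint tag (n : nat) : M := match n with 0 => emp | S n => sing (tag n) end.

Lemma tag_inj n m : tag n = tag m -> n = m.
Proof.
  revert m. induction n as [| n IH]; intros [| m] K; cbn in K; try reflexivity.
  - exfalso. apply (in_emp (tag m)). rewrite K. now apply in_sing.
  - exfalso. apply (in_emp (tag n)). rewrite <- K. now apply in_sing.
  - f_equal. apply IH. apply in_sing. rewrite <- K. now apply in_sing.
Qed.

Definition prod (a b : M) : M := Un (rep a (fun x => rep b (fun y => op x y))).

Lemma in_prod a b z : z ∈ prod a b <-> exists x y, x ∈ a /\ y ∈ b /\ z = op x y.
Proof.
  unfold prod. rewrite in_Un. split.
  - intros (w & Hw & Hz). apply in_rep in Hw as (x & Hx & ->); [| def].
    apply in_rep in Hz as (y & Hy & ->); [| def]. eauto.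
  - intros (x & y & Hx & Hy & ->). exists (rep b (fun y => op x y)).
    split; (apply in_rep; [def |]); eauto.
Qed.

(** * Positions of the game *)

(** A position of the game: [xi] is the clock, the elements chosen next are
    taken from [level y], and [p] is a set of pairs of a name and a chosen
    element.  The new value of the clock names the element chosen at a move. *)
Definition pos (xi y p : M) : M := op xi (op y p).
Definition clock (x : M) : M := fst' x.
Definition top (x : M) : M := fst' (snd' x).
Definition names (x : M) : M := snd' (snd' x).
Definition adj (p i x : M) : M := cup p (sing (op i x)).

Lemma clock_pos xi y p : clock (pos xi y p) = xi.
Proof. apply fst_op. Qed.

Lemma top_pos xi y p : top (pos xi y p) = y.
Proof. unfold top, pos. rewrite snd_op. apply fst_op. Qed.

Lemma names_pos xi y p : names (pos xi y p) = p.
Proof. unfold names, pos. rewrite snd_op. apply snd_op. Qed.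

Definition moves (x : M) : M :=
  Un (rep (clock x) (fun eta => rep (level (top x)) (fun c =>
    pos eta (top x) (adj (names x) eta c)))).

(** Lowering [y] is a move of its own, because a strategy for [level y] has to
    yield strategies for the smaller levels with the same named elements. *)
Definition cuts (x : M) : M :=
  Un (rep (clock x) (fun eta => rep (level (top x)) (fun z => pos eta z (names x)))).
Definition later (x : M) : M := cup (moves x) (cuts x).

Lemma term_moves : term1 moves.
Proof. apply term1_intro. unfold moves, pos, clock, top, names, adj. def. Qed.

Lemma term_cuts : term1 cuts.
Proof. apply term1_intro. unfold cuts, pos, clock, top, names, adj. def. Qed.

Lemma term_later : term1 later.
Proof.
  apply term1_intro. apply term_cup; [apply term_moves | apply term_cuts]; def.
Qed.

Lemma in_moves x z : z ∈ moves x <-> exists eta c, eta ∈ clock x /\ c ∈ level (top x) /\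
  z = pos eta (top x) (adj (names x) eta c).
Proof.
  unfold moves. rewrite in_Un. split.
  - intros (w & Hw & Hz). apply in_rep in Hw as (eta & Heta & ->);
      [| unfold pos, adj; def].
    apply in_rep in Hz as (c & Hc & ->); [eauto | unfold pos, adj; def].
  - intros (eta & c & Heta & Hc & ->).
    exists (rep (level (top x)) (fun c => pos eta (top x) (adj (names x) eta c))).
    split; (apply in_rep; [unfold pos, adj; def |]); eauto.
Qed.

Lemma in_cuts x z : z ∈ cuts x <-> exists eta y, eta ∈ clock x /\ y ∈ level (top x) /\
  z = pos eta y (names x).
Proof.
  unfold cuts. rewrite in_Un. split.
  - intros (w & Hw & Hz). apply in_rep in Hw as (eta & Heta & ->);
      [| unfold pos; def].
    apply in_rep in Hz as (c & Hc & ->); [eauto | unfold pos; def].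
  - intros (eta & y & Heta & Hy & ->).
    exists (rep (level (top x)) (fun y => pos eta y (names x))).
    split; (apply in_rep; [unfold pos; def |]); eauto.
Qed.

(** The clock decreases along the game, and all positions reachable from [x]
    form a set.  Induction on the clock within that set is legitimate. *)
Lemma later_induction (P : M -> Prop) :
  S1 (fun e => P (e 0)) -> (forall x, (forall z, z ∈ later x -> P z) -> P x) ->
  forall x, P x.
Proof.
  intros SP IH x.
  set (T := tc (clock x)). set (Y := level (top x)).
  set (Pos := Pw (cup (names x) (prod T Y))).
  assert (T_trans : forall a, a ∈ T -> a ⊆ T) by apply tc_transitive.
  assert (Pos_adj : forall p i c, p ∈ Pos -> i ∈ T -> c ∈ Y -> adj p i c ∈ Pos).
  { intros p i c Hp Hi Hc. apply in_Pw. intros z Hz. apply in_cup in Hz as [Hz | Hz].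
    - apply in_Pw in Hp. exact (Hp z Hz).
    - apply in_sing in Hz. subst z. apply in_cup. right. apply in_prod. eauto. }
  assert (inside : forall z,
            (forall a, a ∈ clock z -> a ∈ T) -> top z ∈ Y -> names z ∈ Pos ->
            forall w, w ∈ later z ->
            exists eta y p, eta ∈ clock z /\ y ∈ Y /\ p ∈ Pos /\ w = pos eta y p).
  { intros z Hz1 Hz2 Hz3 w Hw. apply in_cup in Hw as [Hw | Hw].
    - apply in_moves in Hw as (eta & c & Heta & Hc & ->).
      exists eta, (top z), (adj (names z) eta c). repeat (split; auto).
      apply Pos_adj; auto. exact (level_trans _ _ _ Hc Hz2).
    - apply in_cuts in Hw as (eta & y & Heta & Hy & ->).
      exists eta, y, (names z). repeat (split; auto).
      exact (level_trans _ _ _ Hy Hz2). }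
  assert (K : forall xi, ~ xi ∈ T \/
            forall y, y ∈ Y -> forall p, p ∈ Pos -> P (pos xi y p)).
  { refine (S1_induction _ _ _).
    - unfold pos. def.
    - intros xi IHxi. destruct (classic (xi ∈ T)) as [Hxi | Hxi]; [right | auto].
      intros y Hy p Hp. apply IH. intros w Hw.
      destruct (inside (pos xi y p)) with (w := w) as (eta & z & q & Heta & Hz & Hq & ->);
        rewrite ?clock_pos, ?top_pos, ?names_pos; auto.
      + intros a Ha. exact (T_trans xi Hxi a Ha).
      + rewrite clock_pos in Heta.
        destruct (IHxi eta Heta) as [N | L]; [| exact (L z Hz q Hq)].
        exfalso. exact (N (T_trans xi Hxi eta Heta)). }
  assert (HT : forall a, a ∈ clock x -> a ∈ T) by (intros a Ha; apply in_tc; auto).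
  apply IH. intros w Hw.
  destruct (inside x HT (level_refl _)) with (w := w) as (eta & y & p & Heta & Hy & Hp & ->);
    [| exact Hw |].
  - apply in_Pw. intros z Hz. apply in_cup. auto.
  - destruct (K eta) as [N | L]; [exfalso; exact (N (HT eta Heta)) | exact (L y Hy p Hp)].
Qed.

(** * Types of positions *)

Section Types.

(** [base] is to be fixed pointwise, and the elements of [zeta] serve as names. *)
Variables (base zeta : M).

Definition fact_args : M := cup zeta base.
Definition fact_codes : M :=
  prod (cup (upair (tag 0) (tag 1)) (upair (tag 2) (tag 3))) (prod fact_args fact_args).

(** The coded atomic facts about the elements named by [p].  Those in [base] are
    recorded by themselves, so that equal facts force them to correspond to
    themselves. *)
Definition facts (p : M) : M :=
  compr fact_codes (fun l =>
    (exists i, i ∈ fact_args /\ exists j, j ∈ fact_args /\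
     exists x, x ∈ Un (Un p) /\ exists y, y ∈ Un (Un p) /\
       op i x ∈ p /\ op j y ∈ p /\
       ((l = op (tag 0) (op i j) /\ x ∈ y) \/
        (l = op (tag 1) (op i j) /\ x = y) \/
        (l = op (tag 2) (op i j) /\ x ∈ level y))) \/
    (exists i, i ∈ fact_args /\ exists x, x ∈ base /\ op i x ∈ p /\ l = op (tag 3) (op i x))).

Lemma term_facts : term1 facts.
Proof. apply term1_intro. unfold facts. def. Qed.

Ltac def_game :=
  cbv beta; repeat first
    [ lazymatch goal with
      | |- term (fun e => facts (@?t e)) => apply (term_facts t)
      | |- term (fun e => moves (@?t e)) => apply (term_moves t)
      | |- term (fun e => cuts (@?t e)) => apply (term_cuts t)
      end
    | def_step ].

(** The type of a position determines the facts that hold there and, for each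
    kind of move and each later clock value, the types that can be reached. *)
Definition typ_step (x f : M) : M :=
  cup (facts (names x))
    (cup (rep (moves x) (fun z => op (tag 4) (op (clock z) (app f z))))
         (rep (cuts x) (fun z => op (tag 5) (op (clock z) (app f z))))).

Lemma term_typ_step t u : term t -> term u -> term (fun e => typ_step (t e) (u e)).
Proof.
  apply term2_intro. unfold typ_step, clock, names. def_game.
Qed.

Definition typ : M -> M :=
  proj1_sig (constructive_indefinite_description _
    (recursion later typ_step term_later term_typ_step later_induction)).

Lemma typ_spec : term1 typ /\ forall x, typ x = typ_step x (graph typ (later x)).
Proof.
  exact (proj2_sig (constructive_indefinite_description _
    (recursion later typ_step term_later term_typ_step later_induction))).
Qed.

Definition term_typ : term1 typ := proj1 typ_spec.

Lemma in_typ x l : l ∈ typ x <-> l ∈ facts (names x) \/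
  (exists z, z ∈ moves x /\ l = op (tag 4) (op (clock z) (typ z))) \/
  (exists z, z ∈ cuts x /\ l = op (tag 5) (op (clock z) (typ z))).
Proof.
  rewrite (proj2 typ_spec x). unfold typ_step. rewrite !in_cup.
  assert (T : forall k, term (fun e =>
            op (tag k) (op (clock (e 0)) (app (graph typ (later x)) (e 0))))).
  { intros k. unfold clock. def. }
  rewrite !in_rep by apply T.
  assert (K : forall z, z ∈ later x -> app (graph typ (later x)) z = typ z).
  { intros z. apply app_graph, term_typ. }
  split; (intros [L | [(z & Hz & ->) | (z & Hz & ->)]];
    [auto | right; left | right; right]); exists z; rewrite K;
    auto; apply in_cup; auto.
Qed.

Lemma in_facts p l : l ∈ facts p <-> l ∈ fact_codes /\
  ((exists i j x y, i ∈ fact_args /\ j ∈ fact_args /\ op i x ∈ p /\ op j y ∈ p /\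
       ((l = op (tag 0) (op i j) /\ x ∈ y) \/
        (l = op (tag 1) (op i j) /\ x = y) \/
        (l = op (tag 2) (op i j) /\ x ∈ level y))) \/
   exists i x, i ∈ fact_args /\ x ∈ base /\ op i x ∈ p /\ l = op (tag 3) (op i x)).
Proof.
  unfold facts. rewrite in_compr by def. split.
  - intros [HU [(i & Hi & j & Hj & x & _ & y & _ & K) | (i & Hi & x & K)]];
      (split; [exact HU |]); [left | right]; [exists i, j, x, y | exists i, x]; tauto.
  - intros [HU [(i & j & x & y & Hi & Hj & K) | (i & x & Hi & K)]]; (split; [exact HU |]).
    + left. exists i. split; [exact Hi |]. exists j. split; [exact Hj |].
      exists x. split; [apply (op_in_field _ _ _ (proj1 K)) |].
      exists y. split; [apply (op_in_field _ _ _ (proj1 (proj2 K))) | exact K].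
    + right. eauto.
Qed.

Lemma facts_tag p l : l ∈ facts p -> exists k u, k < 4 /\ l = op (tag k) u.
Proof.
  intros K. apply in_facts in K as [K _]. apply in_prod in K as (a & u & Ha & _ & ->).
  apply in_cup in Ha as [Ha | Ha]; apply in_upair in Ha as [-> | ->];
    [exists 0 | exists 1 | exists 2 | exists 3]; exists u; (split; [lia | reflexivity]).
Qed.

Lemma in_fact_codes k i j :
  k < 4 -> i ∈ fact_args -> j ∈ fact_args -> op (tag k) (op i j) ∈ fact_codes.
Proof.
  intros Hk Hi Hj. apply in_prod. exists (tag k), (op i j).
  split; [| split; [apply in_prod; eauto | reflexivity]].
  rewrite in_cup, !in_upair.
  destruct k as [| [| [| [| k]]]]; auto; lia.
Qed.

(** The relation that a type records under [tag k]. *)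
Definition rel (k : nat) (x y : M) : Prop :=
  match k with 0 => x ∈ y | 1 => x = y | _ => x ∈ level y end.

Lemma rel_fact k i j p : k < 3 -> i ∈ fact_args -> j ∈ fact_args ->
  op (tag k) (op i j) ∈ facts p <-> exists x y, op i x ∈ p /\ op j y ∈ p /\ rel k x y.
Proof.
  intros Hk Hi Hj. rewrite in_facts. split.
  - intros [_ [(i' & j' & x & y & _ & _ & Hx & Hy & K) | (i' & x & _ & _ & _ & K)]].
    + exists x, y.
      destruct K as [[K R] | [[K R] | [K R]]]; apply op_inj in K as [K K'];
        apply op_inj in K' as [<- <-]; apply tag_inj in K; subst k; auto.
    + apply op_inj in K as [K _]. apply tag_inj in K. lia.
  - intros (x & y & Hx & Hy & K). split; [apply in_fact_codes; auto; lia |].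
    left. exists i, j, x, y. repeat (split; [assumption |]).
    destruct k as [| [| [| k]]]; cbn in K; auto; lia.
Qed.

Lemma const_fact i x p : i ∈ fact_args -> x ∈ base ->
  op (tag 3) (op i x) ∈ facts p <-> op i x ∈ p.
Proof.
  intros Hi Hx. rewrite in_facts. split.
  - intros [_ [(i' & j' & u & v & _ & _ & _ & _ & K) | (i' & u & _ & _ & K & E1)]].
    + destruct K as [[K _] | [[K _] | [K _]]]; apply op_inj in K as [K _];
        apply tag_inj in K; lia.
    + apply op_inj in E1 as [_ E1]. apply op_inj in E1 as [-> ->]. exact K.
  - intros K. split; [| right; exists i, x; auto].
    apply in_fact_codes; [lia | exact Hi | apply in_cup; auto].
Qed.

Section SameType.

Variables (xi y y' p p' : M).
Hypothesis same : typ (pos xi y p) = typ (pos xi y' p').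

Lemma same_facts : facts p = facts p'.
Proof.
  assert (K : forall z z' q q', typ (pos xi z q) = typ (pos xi z' q') ->
            forall l, l ∈ facts q -> l ∈ facts q').
  { intros z z' q q' T l Hl.
    assert (L : l ∈ typ (pos xi z' q')).
    { rewrite <- T. apply in_typ. left. now rewrite names_pos. }
    apply facts_tag in Hl as (k & u & Hk & ->). apply in_typ in L.
    rewrite names_pos in L.
    destruct L as [L | [(w & _ & L) | (w & _ & L)]]; [exact L | |];
      apply op_inj in L as [L _]; apply tag_inj in L; lia. }
  apply extensionality_sets. intros l. split; eapply K; eauto.
Qed.

Lemma same_move eta c : eta ∈ xi -> c ∈ level y -> exists c', c' ∈ level y' /\
  typ (pos eta y (adj p eta c)) = typ (pos eta y' (adj p' eta c')).
Proof.
  intros Heta Hc. set (z := pos eta y (adj p eta c)).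
  assert (K : op (tag 4) (op eta (typ z)) ∈ typ (pos xi y' p')).
  { rewrite <- same. apply in_typ. right; left. exists z.
    split; [| unfold z; now rewrite clock_pos].
    apply in_moves. exists eta, c. rewrite clock_pos, top_pos, names_pos. auto. }
  apply in_typ in K as [K | [(w & Hw & K) | (w & Hw & K)]].
  - apply facts_tag in K as (k & u & Hk & K). apply op_inj in K as [K _].
    apply tag_inj in K. lia.
  - apply in_moves in Hw as (eta' & c' & _ & Hc' & ->).
    rewrite top_pos, names_pos, clock_pos in *.
    apply op_inj in K as [_ K]. apply op_inj in K as [<- K]. eauto.
  - apply op_inj in K as [K _]. apply tag_inj in K. lia.
Qed.

Lemma same_cut eta z : eta ∈ xi -> z ∈ level y -> exists z', z' ∈ level y' /\
  typ (pos eta z p) = typ (pos eta z' p').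
Proof.
  intros Heta Hz. set (w := pos eta z p).
  assert (K : op (tag 5) (op eta (typ w)) ∈ typ (pos xi y' p')).
  { rewrite <- same. apply in_typ. right; right. exists w.
    split; [| unfold w; now rewrite clock_pos].
    apply in_cuts. exists eta, z. rewrite clock_pos, top_pos, names_pos. auto. }
  apply in_typ in K as [K | [(v & Hv & K) | (v & Hv & K)]].
  - apply facts_tag in K as (k & u & Hk & K). apply op_inj in K as [K _].
    apply tag_inj in K. lia.
  - apply op_inj in K as [K _]. apply tag_inj in K. lia.
  - apply in_cuts in Hv as (eta' & z' & _ & Hz' & ->).
    rewrite top_pos, names_pos, clock_pos in *.
    apply op_inj in K as [_ K]. apply op_inj in K as [<- K]. eauto.
Qed.

End SameType.

(** The same recursion as for types, with all subsets taken: [bound xi] contains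
    every type with clock [xi], whatever the level and the named elements. *)
Definition bound_step (xi f : M) : M :=
  Pw (cup fact_codes (prod (upair (tag 4) (tag 5)) (prod xi (Un (rep xi (fun eta => app f eta)))))).

Lemma term_bound_step t u : term t -> term u -> term (fun e => bound_step (t e) (u e)).
Proof. apply term2_intro. unfold bound_step, prod. def. Qed.

Definition bound : M -> M := solution bound_step term_bound_step.

Lemma in_bound xi w :
  (forall l, l ∈ w -> l ∈ fact_codes \/ exists k eta s, (k = 4 \/ k = 5) /\ eta ∈ xi /\
     s ∈ bound eta /\ l = op (tag k) (op eta s)) ->
  w ∈ bound xi.
Proof.
  intros K. unfold bound. rewrite (proj2 (solution_spec _ _)). fold bound.
  apply in_Pw. intros l Hl. apply in_cup.
  destruct (K l Hl) as [L | (k & eta & s & Hk & Heta & Hs & ->)]; [auto | right].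
  apply in_prod. exists (tag k), (op eta s).
  split; [apply in_upair; destruct Hk; subst k; auto |]. split; [| reflexivity].
  apply in_prod. exists eta, s. split; [exact Heta |]. split; [| reflexivity].
  apply in_Un. exists (bound eta). split; [| exact Hs].
  apply in_rep; [def |]. exists eta. split; [exact Heta |].
  symmetry. apply app_graph; [apply solution_spec | exact Heta].
Qed.

Lemma typ_bound x : typ x ∈ bound (clock x).
Proof.
  revert x. refine (later_induction _ _ _).
  { apply S1_D1, D1_mem; [apply term_typ; def |].
    apply (proj1 (solution_spec _ term_bound_step)). unfold clock. def. }
  intros x IH. apply in_bound. intros l Hl.
  apply in_typ in Hl as [Hl | [(z & Hz & ->) | (z & Hz & ->)]].
  - left. apply in_facts in Hl. apply Hl.
  - right. exists 4, (clock z), (typ z). split; [auto |].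
    split; [| split; [apply IH, in_cup; auto | reflexivity]].
    apply in_moves in Hz as (eta & c & Heta & _ & ->). now rewrite clock_pos.
  - right. exists 5, (clock z), (typ z). split; [auto |].
    split; [| split; [apply IH, in_cup; auto | reflexivity]].
    apply in_cuts in Hz as (eta & c & Heta & _ & ->). now rewrite clock_pos.
Qed.

(** * The back-and-forth argument *)

(** Every view of the left-hand side is equivalent to a view of the right-hand
    side inside the set [level b].  The quantifier over [y] is what makes the
    limit of the construction defined on all of [M]. *)
Definition match_below (b xi p q : M) : Prop :=
  forall y, exists y', y' ∈ level b /\ typ (pos xi y p) = typ (pos xi y' q).

(** The types realized form a subset of [bound xi] that is a set by Sigma_1
    separation; [b] collects levels that realize them. *)
Lemma match_start xi : exists b, match_below b xi emp emp.
Proof.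
  destruct (S1_separation (fun s => exists y, s = typ (pos xi y emp)) (bound xi)) as [B HB].
  { def. apply S1_D1, D1_eq; [def | apply term_typ; unfold pos; def]. }
  destruct (S1_collection (fun y s => s = typ (pos xi y emp)) B) as [b Hb].
  { apply S1_D1, D1_eq; [def | apply term_typ; unfold pos; def]. }
  { intros s Hs. apply HB in Hs. apply Hs. }
  exists b. intros y. destruct (Hb (typ (pos xi y emp))) as (y' & Hy' & K).
  - apply HB. split; [| eauto].
    rewrite <- (clock_pos xi y emp) at 2. apply typ_bound.
  - exists y'. split; [now apply mem_level | exact K].
Qed.

(** Collection produces one set of counterexamples to all the failing matches. *)
Lemma collect_unmatched b eta (P : M -> M) (Q : M -> M) a :
  term1 P -> term1 Q ->
  (forall n, n ∈ a -> ~ match_below b eta (P n) (Q n)) ->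
  exists Y, forall n, n ∈ a -> exists y, y ∈ Y /\
    forall y', y' ∈ level b -> typ (pos eta y (P n)) <> typ (pos eta y' (Q n)).
Proof.
  intros HP HQ K.
  apply (S1_collection (fun y n => forall y', y' ∈ level b ->
           typ (pos eta y (P n)) <> typ (pos eta y' (Q n)))).
  - apply S1_D1. apply (D1_ball (fun e y' =>
      typ (pos eta (e 0) (P (e 1))) <> typ (pos eta y' (Q (e 1))))); [def |].
    apply D1_not, D1_eq; apply term_typ; unfold pos; def.
  - intros n Hn. apply NNPP. intros N. apply (K n Hn). intros y.
    apply NNPP. intros Ny. apply N. exists y. intros y' Hy' T. apply Ny. eauto.
Qed.

(** The answer to [m] in a level above all counterexamples in [Y] is matched at
    each of them, by a cut. *)
Lemma forth_step b xi eta eta' p q m :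
  match_below b xi p q -> eta ∈ xi -> eta' ∈ eta ->
  exists n, n ∈ level b /\ match_below b eta' (adj p eta m) (adj q eta n).
Proof.
  intros Hm Heta Heta'. apply NNPP. intros N.
  destruct (collect_unmatched b eta' (fun _ => adj p eta m) (fun n => adj q eta n) (level b))
    as [Y HY].
  - intros t Ht. apply term_const.
  - intros t Ht. unfold adj. def.
  - intros n Hn K. eauto.
  - set (y := cup Y (sing m)).
    destruct (Hm y) as (y' & Hy' & T).
    destruct (same_move _ _ _ _ _ T eta m Heta) as (n & Hn & T1).
    { apply mem_level, in_cup. right. now apply in_sing. }
    destruct (HY n (level_trans _ _ _ Hn Hy')) as (z & Hz & Hbad).
    destruct (same_cut _ _ _ _ _ T1 eta' z Heta') as (z' & Hz' & T2).
    { apply mem_level, in_cup. auto. }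
    exact (Hbad z' (level_trans _ _ _ Hz' Hy') T2).
Qed.

(** As in [forth_step], with the roles exchanged.  The candidates [m] have to
    range over a set, which [level x0] provides because types record rank
    comparisons.  Playing [x0] shows that [y0], and with it [n], is available in
    the level of the right-hand side. *)
Lemma back_step b xi eta eta' p q x0 y0 n :
  match_below b xi p q -> eta ∈ xi -> eta' ∈ eta ->
  (forall c, facts (adj p eta x0) = facts (adj q eta c) -> c = y0) ->
  (forall c, facts (adj p eta c) = facts (adj q eta n) -> c ∈ level x0) ->
  n ∈ level y0 ->
  exists m, m ∈ level x0 /\ match_below b eta' (adj p eta m) (adj q eta n).
Proof.
  intros Hm Heta Heta' Hx Hle Hn. apply NNPP. intros N.
  destruct (collect_unmatched b eta' (fun m => adj p eta m) (fun _ => adj q eta n) (level x0))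
    as [Y HY].
  - intros t Ht. unfold adj. def.
  - intros t Ht. apply term_const.
  - intros m Hm' K. eauto.
  - set (y := cup Y (sing x0)).
    destruct (Hm y) as (y' & Hy' & T).
    assert (Hy0 : y0 ∈ level y').
    { destruct (same_move _ _ _ _ _ T eta x0 Heta) as (c & Hc & T1).
      - apply mem_level, in_cup. right. now apply in_sing.
      - rewrite <- (Hx c (same_facts _ _ _ _ _ T1)). exact Hc. }
    destruct (same_move _ _ _ _ _ (eq_sym T) eta n Heta (level_trans _ _ _ Hn Hy0))
      as (m & _ & T1).
    apply eq_sym in T1.
    destruct (HY m (Hle m (same_facts _ _ _ _ _ T1))) as (z & Hz & Hbad).
    destruct (same_cut _ _ _ _ _ T1 eta' z Heta') as (z' & Hz' & T2).
    { apply mem_level, in_cup. auto. }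
    exact (Hbad z' (level_trans _ _ _ Hz' Hy') T2).
Qed.

Section Matching.

Variable b : M.
Hypothesis zeta_ord : ord zeta.

(** A finite stage of the construction lists triples of a name, the named
    element, and its image. *)
Definition stage : Type := list (M * M * M).

Fixpoint left_names (L : stage) : M :=
  match L with nil => emp | (i, x, _) :: L => adj (left_names L) i x end.

Fixpoint right_names (L : stage) : M :=
  match L with nil => emp | (i, _, y) :: L => adj (right_names L) i y end.

Definition named (L : stage) : Prop :=
  (forall i x y, In (i, x, y) L -> i ∈ zeta) /\
  (forall i x y x' y', In (i, x, y) L -> In (i, x', y') L -> x = x' /\ y = y').

(** The clock is below all names in use, so that later names are fresh, and it is
    not accessible, so that the construction can continue. *)
Definition good (xi : M) (L : stage) : Prop :=
  ~ Acc E xi /\ xi ∈ cup zeta (sing zeta) /\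
  (forall i x y, In (i, x, y) L -> xi ∈ i) /\ named L /\
  match_below b xi (left_names L) (right_names L).

Lemma in_left_names L i x : op i x ∈ left_names L <-> exists y, In (i, x, y) L.
Proof.
  induction L as [| [[j u] v] L IH]; cbn.
  - split; [intros K; destruct (in_emp _ K) | intros [y []]].
  - unfold adj. rewrite in_cup, in_sing, IH. split.
    + intros [[y K] | K]; [eauto |]. apply op_inj in K as [-> ->]. eauto.
    + intros [y [K | K]]; [right | eauto]. now inversion K.
Qed.

Lemma in_right_names L i y : op i y ∈ right_names L <-> exists x, In (i, x, y) L.
Proof.
  induction L as [| [[j u] v] L IH]; cbn.
  - split; [intros K; destruct (in_emp _ K) | intros [x []]].
  - unfold adj. rewrite in_cup, in_sing, IH. split.
    + intros [[x K] | K]; [eauto |]. apply op_inj in K as [-> ->]. eauto.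
    + intros [x [K | K]]; [right | eauto]. now inversion K.
Qed.

(** Names are used once, so a fact about names is a fact about elements. *)
Lemma named_rel L k i x y j x' y' : k < 3 ->
  named L -> facts (left_names L) = facts (right_names L) ->
  In (i, x, y) L -> In (j, x', y') L -> rel k x x' <-> rel k y y'.
Proof.
  intros Hk [N1 N2] F Hi Hj.
  assert (Wi : i ∈ fact_args) by (apply in_cup; left; eauto).
  assert (Wj : j ∈ fact_args) by (apply in_cup; left; eauto).
  transitivity (op (tag k) (op i j) ∈ facts (left_names L)).
  - rewrite rel_fact by assumption. split.
    + intros R. exists x, x'. rewrite !in_left_names. eauto.
    + intros (u & u' & Hu & Hu' & R).
      apply in_left_names in Hu as [v Hu]. apply in_left_names in Hu' as [v' Hu'].
      destruct (N2 _ _ _ _ _ Hi Hu) as [-> _]. now destruct (N2 _ _ _ _ _ Hj Hu') as [-> _].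
  - rewrite F, rel_fact by assumption. split.
    + intros (u & u' & Hu & Hu' & R).
      apply in_right_names in Hu as [v Hu]. apply in_right_names in Hu' as [v' Hu'].
      destruct (N2 _ _ _ _ _ Hi Hu) as [_ ->]. now destruct (N2 _ _ _ _ _ Hj Hu') as [_ ->].
    + intros R. exists y, y'. rewrite !in_right_names. eauto.
Qed.

Lemma named_const L i x y :
  named L -> facts (left_names L) = facts (right_names L) ->
  In (i, x, y) L -> x ∈ base -> y = x.
Proof.
  intros [N1 N2] F Hi Hx.
  assert (Wi : i ∈ fact_args) by (apply in_cup; left; eauto).
  assert (K : op (tag 3) (op i x) ∈ facts (left_names L)).
  { apply const_fact; [assumption.. |]. apply in_left_names. eauto. }
  rewrite F, const_fact, in_right_names in K by assumption. destruct K as [u K].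
  apply (N2 _ _ _ _ _ Hi K).
Qed.

Lemma good_named xi L : good xi L -> named L.
Proof. intros (_ & _ & _ & N & _). exact N. Qed.

Lemma good_facts xi L : good xi L -> facts (left_names L) = facts (right_names L).
Proof.
  intros (_ & _ & _ & _ & K). destruct (K point) as (y' & _ & T).
  exact (same_facts _ _ _ _ _ T).
Qed.

Lemma good_ord xi L : good xi L -> ord xi /\ xi ⊆ zeta.
Proof.
  intros (_ & K & _). apply in_cup in K as [K | K].
  - split; [exact (ord_mem _ _ zeta_ord K) | exact (proj1 zeta_ord _ K)].
  - apply in_sing in K. subst xi. split; [exact zeta_ord | intros z Hz; exact Hz].
Qed.

Lemma named_cons xi L eta m n : good xi L -> eta ∈ xi -> named ((eta, m, n) :: L).
Proof.
  intros G Heta. destruct (good_ord _ _ G) as [O Hz]. destruct G as (_ & _ & F & [N1 N2] & _).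
  assert (fresh : forall x y, ~ In (eta, x, y) L).
  { intros x y K. apply (mem_irrefl xi).
    exact (proj1 O eta Heta xi (F _ _ _ K)). }
  split.
  - intros i x y [K | K]; [injection K as <- _ _; exact (Hz eta Heta) | eauto].
  - intros i x y x' y' [K | K] [K' | K'].
    + inversion K. inversion K'. subst. auto.
    + injection K as <- _ _. exfalso. exact (fresh _ _ K').
    + injection K' as <- _ _. exfalso. exact (fresh _ _ K).
    + eauto.
Qed.

Lemma good_cons xi L eta eta' m n :
  good xi L -> eta ∈ xi -> eta' ∈ eta -> ~ Acc E eta' ->
  match_below b eta' (adj (left_names L) eta m) (adj (right_names L) eta n) ->
  good eta' ((eta, m, n) :: L).
Proof.
  intros G Heta Heta' N K.
  assert (NC := named_cons xi L eta m n G Heta).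
  destruct (good_ord _ _ G) as [O Hz]. destruct G as (_ & _ & F & [N1 _] & _).
  split; [exact N |].
  split; [apply in_cup; left; exact (Hz _ (proj1 O eta Heta eta' Heta')) |].
  split; [| split; [exact NC | exact K]].
  intros i x y [L1 | L1]; [injection L1 as <- _ _; exact Heta' |].
  assert (Oi := ord_mem _ _ zeta_ord (N1 _ _ _ L1)).
  exact (proj1 Oi eta (proj1 Oi xi (F _ _ _ L1) eta Heta) eta' Heta').
Qed.

Lemma clock_step xi L : good xi L ->
  exists eta eta', eta ∈ xi /\ eta' ∈ eta /\ ~ Acc E eta'.
Proof.
  intros (N & _). destruct (not_Acc_step xi N) as (eta & Heta & N1).
  destruct (not_Acc_step eta N1) as (eta' & Heta' & N2). eauto.
Qed.

Lemma good_forth xi L m : good xi L ->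
  exists xi' i n, good xi' ((i, m, n) :: L).
Proof.
  intros G. destruct (clock_step xi L G) as (eta & eta' & Heta & Heta' & N).
  assert (K := G). destruct K as (_ & _ & _ & _ & K).
  destruct (forth_step b xi eta eta' _ _ m K Heta Heta') as (n & _ & Hn).
  exists eta', eta, n. exact (good_cons xi L eta eta' m n G Heta Heta' N Hn).
Qed.

Lemma good_back xi L i x y n : good xi L -> In (i, x, y) L -> n ∈ level y ->
  exists xi' j m, good xi' ((j, m, n) :: L).
Proof.
  intros G Hi Hn. destruct (clock_step xi L G) as (eta & eta' & Heta & Heta' & N).
  assert (K := G). destruct K as (_ & _ & _ & _ & K).
  destruct (back_step b xi eta eta' (left_names L) (right_names L) x y n) as (m & _ & Hm);
    try assumption.
  - intros c F.
    exact (proj1 (named_rel ((eta, x, c) :: L) 1 eta x c i x y ltac:(lia)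
      (named_cons xi L eta x c G Heta) F (or_introl eq_refl) (or_intror Hi)) eq_refl).
  - intros c F.
    exact (proj2 (named_rel ((eta, c, n) :: L) 2 eta c n i x y ltac:(lia)
      (named_cons xi L eta c n G Heta) F (or_introl eq_refl) (or_intror Hi)) Hn).
  - exists eta', eta, m. exact (good_cons xi L eta eta' m n G Heta Heta' N Hm).
Qed.

(** The requirements met by the limit of the construction: [m] is in the
    domain, and [n] is in the range if its rank obliges it to be. *)
Definition meets (m n : M) (L : stage) : Prop :=
  exists i y, In (i, m, y) L /\ (n ∈ level y -> exists j x, In (j, x, n) L).

Lemma good_meets xi L m n : good xi L ->
  exists xi' L', good xi' L' /\ incl L L' /\ meets m n L'.
Proof.
  intros G. destruct (good_forth xi L m G) as (xi1 & i & y & G1).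
  destruct (classic (n ∈ level y)) as [Hn | Hn].
  - destruct (good_back xi1 _ i m y n G1 (or_introl eq_refl) Hn) as (xi2 & j & x & G2).
    exists xi2, ((j, x, n) :: (i, m, y) :: L). split; [exact G2 |].
    split; [intros z Hz; right; now right |].
    exists i, y. split; [right; now left |]. intros _. exists j, x. now left.
  - exists xi1, ((i, m, y) :: L). split; [exact G1 |].
    split; [intros z Hz; now right |].
    exists i, y. split; [now left |]. intros K. contradiction.
Qed.

(** Playing [x] once more gets an answer in [level b], and since types record
    equality the answer is [y]. *)
Lemma good_range xi L i x y : good xi L -> In (i, x, y) L -> y ∈ level b.
Proof.
  intros G Hi. destruct (clock_step xi L G) as (eta & eta' & Heta & Heta' & N).
  assert (K := G). destruct K as (_ & _ & _ & _ & K).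
  destruct (forth_step b xi eta eta' _ _ x K Heta Heta') as (n & Hn & Hm).
  assert (G' := good_cons xi L eta eta' x n G Heta Heta' N Hm).
  assert (R := named_rel _ 1 eta x n i x y ltac:(lia) (good_named _ _ G')
                 (good_facts _ _ G') (or_introl eq_refl) (or_intror Hi)).
  cbn in R. rewrite <- (proj1 R eq_refl). exact Hn.
Qed.

(** The union of a chain of stages that meets all requirements. *)
Lemma embedding_of_match :
  countable M -> ~ Acc E zeta -> match_below b zeta emp emp ->
  exists i : M -> M, (forall x y, x ∈ y <-> i x ∈ i y) /\ Injective i /\
    (forall x, i x ∈ level b) /\ (forall m n, n ∈ level (i m) -> exists k, i k = n) /\
    (forall x, x ∈ base -> i x = x).
Proof.
  intros [code code_inj] Nz M0.
  assert (G0 : good zeta nil).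
  { split; [exact Nz |]. split; [apply in_cup; right; now apply in_sing |].
    split; [intros i x y [] |]. split; [split; [intros i x y [] | intros i x y x' y' []] |].
    exact M0. }
  set (St := {s : M * stage | good (fst s) (snd s)}).
  destruct (dependent_choice St (fun k s s' =>
      incl (snd (proj1_sig s)) (snd (proj1_sig s')) /\
      forall m n, to_nat (code m, code n) = k -> meets m n (snd (proj1_sig s')))
    (exist _ (zeta, nil) G0)) as (f & _ & Hf).
  { intros k [[xi L] G].
    destruct (classic (exists m n, to_nat (code m, code n) = k)) as [(m & n & Hk) | Nk].
    - destruct (good_meets xi L m n G) as (xi' & L' & G' & I & Mt).
      exists (exist _ (xi', L') G'). split; [exact I |]. intros m' n' Hk'.
      rewrite <- Hk in Hk'. apply to_nat_inj in Hk'. injection Hk' as Km Kn.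
      apply code_inj in Km, Kn. subst. exact Mt.
    - exists (exist _ (xi, L) G). split; [intros z Hz; exact Hz |]. intros m n Hk.
      exfalso. eauto. }
  set (L := fun k => snd (proj1_sig (f k))).
  assert (good_L : forall k, exists xi, good xi (L k)).
  { intros k. exists (fst (proj1_sig (f k))). exact (proj2_sig (f k)). }
  assert (mono : forall k j, k <= j -> incl (L k) (L j)).
  { intros k j Hkj. induction Hkj as [| j _ IH]; [intros z Hz; exact Hz |].
    intros z Hz. exact (proj1 (Hf j) z (IH z Hz)). }
  set (T := fun x y => exists k i, In (i, x, y) (L k)).
  assert (T_meets : forall m n, exists y, T m y /\ (n ∈ level y -> exists x, T x n)).
  { intros m n. destruct (proj2 (Hf _) m n eq_refl) as (i & y & Hi & Hn).
    exists y. split; [do 2 eexists; exact Hi |]. intros K.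
    destruct (Hn K) as (j & x & Hj). exists x. do 2 eexists. exact Hj. }
  assert (T_rel : forall r x y x' y', r < 3 -> T x y -> T x' y' -> rel r x x' <-> rel r y y').
  { intros r x y x' y' Hr (k & i & Hi) (k' & i' & Hi').
    destruct (good_L (k + k')) as [xi G].
    apply (named_rel (L (k + k')) r i x y i' x' y' Hr (good_named _ _ G) (good_facts _ _ G)).
    - apply (mono k); [lia | exact Hi].
    - apply (mono k'); [lia | exact Hi']. }
  set (i := fun x => epsilon (inhabits point) (T x)).
  assert (Ti : forall x, T x (i x)).
  { intros x. apply epsilon_spec. destruct (T_meets x x) as (y & Hy & _). eauto. }
  assert (T_i : forall x y, T x y -> i x = y).
  { intros x y Hy. exact (proj1 (T_rel 1 x (i x) x y ltac:(lia) (Ti x) Hy) eq_refl). }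
  exists i. split; [| split; [| split; [| split]]].
  - intros x y. exact (T_rel 0 x (i x) y (i y) ltac:(lia) (Ti x) (Ti y)).
  - intros x y. exact (proj2 (T_rel 1 x (i x) y (i y) ltac:(lia) (Ti x) (Ti y))).
  - intros x. destruct (Ti x) as (k & j & Hj). destruct (good_L k) as [xi G].
    exact (good_range _ _ _ _ _ G Hj).
  - intros m n Hn. destruct (T_meets m n) as (y & Hy & K).
    rewrite (T_i m y Hy) in Hn. destruct (K Hn) as [x Hx]. eauto.
  - intros x Hx. destruct (Ti x) as (k & j & Hj). destruct (good_L k) as [xi G].
    exact (named_const _ _ _ _ (good_named _ _ G) (good_facts _ _ G) Hj Hx).
Qed.

End Matching.

End Types.

Lemma embeddings_of_separation a :
  countable M -> nonstandard E -> ordinal E a ->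
  exists i : M -> M,
    self_embedding E i /\ proper i /\ rank_initial E i /\ fixes_below E i a.
Proof.
  intros HC HN Ha. destruct (nonstandard_ord HN) as (zeta & Hz & Nz).
  destruct (match_start (level a) zeta zeta) as [b Hb].
  destruct (embedding_of_match (level a) zeta b Hz HC Nz Hb)
    as (i & i_mem & i_inj & i_bound & i_init & i_fix).
  exists i. split; [split; assumption |]. split; [| split].
  - intros Surj. destruct (Surj (sing b)) as [x Hx].
    apply (sing_not_in_level b). rewrite <- Hx. apply i_bound.
  - intros m n K. apply rank_le_level in K. eauto.
  - intros m K. apply i_fix. apply rank_lt_level; [now apply ordinal_ord | exact K].
Qed.

End Construction.

End Model.

Theorem theorem7p16 :
  forall (M : Type) (E : M -> M -> Prop),
    models E KPP -> countable M -> nonstandard E ->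
    (models E (Separation (SigmaP 1)) <->
     forall a : M, ordinal E a ->
       exists i : M -> M,
         self_embedding E i /\ proper i /\ rank_initial E i /\ fixes_below E i a).
Proof.
  intros M E HM HC HN.
  assert (HI := HN). apply not_all_ex_not in HI as [point _]. split.
  - intros Sep a Ha. exact (embeddings_of_separation M E HM point Sep a HC HN Ha).
  - exact (separation_of_embeddings M E HM point).
Qed.
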